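(* Let $P$ be a prime number and let $\kappa$ be a cardinal with $1\le\kappa\leq\omega_1$. Suppose that there exists an infinite topological Abelian group $H$ of order $P$ without non-trivial convergent sequences such that $H^\gamma$ is countably compact for every cardinal $\gamma<\kappa$. Then there exists a topological Abelian group $G$ of order $P$ such that $G^\gamma$ is countably compact for each cardinal $\gamma<\kappa$ and $G^\kappa$ is not countably compact.
   Context: All topological groups are Hausdorff, and powers carry the product topology. An Abelian group is ''of order $P$'' ($P$ prime) if $P\cdot g=0$ for every element $g$, i.e. it is a vector space over the field $\mathbb Z_P=\mathbb Z/P\mathbb Z$ (this refers to the exponent, not the cardinality). Cardinals $\gamma,\kappa$ may be finite. A space is countably compact if every sequence in it has an accumulation point, where $x$ is an accumulation point of $(x_n)_{n\in\omega}$ if every neighbourhood of $x$ contains $x_n$ for infinitely many $n$. A non-trivial convergent sequence is a convergent sequence that is not eventually constant. *)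

(* Defs.v *)
From mathcomp Require Export all_boot all_algebra all_classical.
From mathcomp Require Export topology normedtype wochoice.

Set Implicit Arguments.
Unset Strict Implicit.
Unset Printing Implicit Defensive.

Export GRing.Theory.

Local Open Scope classical_set_scope.
Local Open Scope card_scope.
Local Open Scope ring_scope.

(* Cardinals are represented by types: the cardinal of I is that of [set: I]. *)
Definition card_lt (I K : Type) : Prop :=
  [set: I] #<= [set: K] /\ ~ ([set: K] #<= [set: I]).

(* W carries a well-order of type omega_1, i.e., the least uncountable one;
   [well_order] is about non-strict orders. *)
Definition is_omega1 (W : Type) : Prop :=
  exists R : rel W,
    [/\ well_order R,
        ~ countable [set: W] &
        forall x, countable [set y | R y x /\ y <> x]].

Lemma exists_omega1 : exists W : Type, is_omega1 W.
Proof.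
have [R Rwo] := well_ordering_principle (nat -> bool : eqType).
have Rch : wo_chain R predT by move=> A _; exact: Rwo.
have Rtot x y : R x y || R y x by exact: (wo_chainW Rch).
have Ranti x y : R x y -> R y x -> x = y.
  by move=> xy yx; apply: (wo_chain_antisymmetric Rch) => //; rewrite xy.
pose p x := `[< countable [set y | R y x /\ y <> x] >].
exists {x | p x}, (fun x y => R (val x) (val y)); split.
- apply: antisymmetric_well_order => [x y /andP[xy yx]|A [a Aa]].
    by apply: val_inj; apply: Ranti.
  have [|_ [[/asboolP[u Au <-] umin] _]] :=
      Rwo [pred x | `[< exists2 u, u \in A & val u = x >]].
    by exists (val a); apply/asboolP; exists a.
  by exists u; split=> // v Av; apply: umin; apply/asboolP; exists v.
- move=> cW; have cp : countable [set x | p x].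
    apply: sub_countable cW; rewrite -(card_le_eqr (inj_card_eq (in2W val_inj))).
    by apply: subset_card_le => x px; exists (exist _ x px).
  have allp x : p x.
    apply: contraT => npx.
    have [|z [[/negP npz zmin] _]] := Rwo [pred x | ~~ p x]; first by exists x.
    case: npz; apply/asboolP; apply: sub_countable cp.
    apply: subset_card_le => y [yz neyz] /=; apply: contrapT => /negP npy.
    exact/neyz/Ranti/zmin.
  have /countable_injP[f finj] : countable [set: nat -> bool].
    by apply: sub_countable cp; apply: subset_card_le => x _; exact: allp.
  pose g n := `[< exists2 x, f x = n & ~~ x n >].
  have gE : g (f g) = ~~ g (f g).
    apply/asboolP/idP => [[x /finj ->]|]; rewrite ?inE//.
    by exists g.
  by case: (g (f g)) gE.
- move=> x; have /asboolP/countable_injP[f finj] := valP x.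
  apply/countable_injP; exists (f \o val) => y z.
  rewrite !inE => -[yx neyx] [zx nezx] fyz; apply/val_inj/finj => //.
  + by rewrite inE; split=> // /val_inj.
  + by rewrite inE; split=> // /val_inj.
Qed.

Definition accumulation_point (X : topologicalType) (u : nat -> X) (x : X) :=
  forall U : set X, nbhs x U -> infinite_set [set n | U (u n)].

Definition countably_compact (X : topologicalType) : Prop :=
  forall u : nat -> X, exists x, accumulation_point u x.

Definition no_nontrivial_convergent_sequences (X : topologicalType) : Prop :=
  forall (u : nat -> X) (x : X), u @ \oo --> x ->
    exists c, \forall n \near \oo, u n = c.

Definition of_order (P : nat) (G : zmodType) : Prop :=
  forall g : G, g *+ P = 0.

(* Main.v *)
From HB Require Import structures.
Require Import Defs.

(* Let A be the product of H with the group of all functions X -> F_P, where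
   X is the set of all F_P-valued functions on the binary tree, and let each
   node q have a vector e_q = (h_q, xi |-> xi q) with the h_q independent
   in H. Every branch r of the tree gives a sequence f_r(n) = e_(r|n).
   The second coordinate of a p-limit of a nontrivial linear combination of
   branches determines the free ultrafilter p.

   G is a subgroup of A generated by the e_q and by limits x_t added along a
   well-order of length the continuum, so that every relevant family of
   sequences of G receives an accumulation point in G. As H has no nontrivial
   convergent sequences, a Cantor tree of subsequences yields continuum many
   choices of x_t, hence one whose new combinations have first coordinates
   outside a given set of size less than the continuum. Avoiding the first
   coordinates already present keeps the projection G -> H injective, so that
   the argument can be iterated.

   Fix K-many branches. If the limits y_i of all of them along one p lie in
   G, look at the first stage whose group contains a p-limit of a nontrivial
   combination of branches. It adds fewer than K generators, so not all y_i
   are there yet, since linear dependence would produce such a combination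
   earlier. One missing y_i is then forbidden at all later stages; as the
   combination determines p, there are few forbidden values. So G^K is not
   countably compact. *)

Set Implicit Arguments.
Unset Strict Implicit.
Unset Printing Implicit Defensive.

Local Open Scope classical_set_scope.
Local Open Scope card_scope.

(** * Cardinality *)

Lemma sval_inj (X : Type) (P : X -> Prop) : injective (@sval X P).
Proof.
move=> [x px] [y py] /= e; move: px py; rewrite e => px py.
by rewrite (Prop_irrelevance px py).
Qed.

Definition embeds (X Y : Type) : Prop := exists f : X -> Y, injective f.

Lemma embeds_cardE (X Y : Type) : [set: X] #<= [set: Y] <-> embeds X Y.
Proof.
split.
  move=> /card_leP[f]; pose s x : [set: X] := SigSub (mem_setT x).
  exists (fun x => sval (f (s x))) => x y /= fxy.
  have /(congr1 sval) // : s x = s y.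
  by apply: 'inj_f; rewrite ?inE //; apply: val_inj.
move=> [f finj]; have fin : {in [set: X] &, injective f} by move=> x y _ _ /finj.
have /card_esym := inj_card_eq fin.
by rewrite card_eq_le => /andP[h _]; apply: (card_le_trans h); exact: card_leT.
Qed.

Lemma embeds_trans (Y X Z : Type) : embeds X Y -> embeds Y Z -> embeds X Z.
Proof. by move=> [f fi] [g gi]; exists (g \o f); exact: inj_comp. Qed.

Lemma embeds_count (X : countType) : embeds X nat.
Proof. by exists pickle; exact: (pcan_inj (@pickleK X)). Qed.

Lemma embeds_prod (X Y X' Y' : Type) :
  embeds X X' -> embeds Y Y' -> embeds (X * Y) (X' * Y').
Proof.
move=> [f fi] [g gi]; exists (fun z => (f z.1, g z.2)).
by case=> a b [c d] /= [/fi -> /gi ->].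
Qed.

Lemma embeds_sum (X Y X' Y' : Type) :
  embeds X X' -> embeds Y Y' -> embeds (X + Y) (X' + Y').
Proof.
move=> [f fi] [g gi].
exists (fun z => match z with inl x => inl (f x) | inr y => inr (g y) end).
by case=> [a|a] [b|b] // [] => [/fi|/gi] ->.
Qed.

Lemma embeds_fun (I X Y : Type) : embeds X Y -> embeds (I -> X) (I -> Y).
Proof.
move=> [f fi]; exists (fun u => f \o u) => u v uv; apply/funext => i.
by apply: fi; have := congr1 (@^~ i) uv.
Qed.

Lemma embeds_surj (X Y : Type) (y0 : Y) : embeds Y X ->
  exists f : X -> Y, forall y, exists x, f x = y.
Proof.
move=> [g gi]; exists (fun x =>
  if pselect (exists y, g y = x) is left e then projT1 (cid e) else y0) => y.
exists (g y); case: pselect => [e|[]]; last by exists y.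
by apply: gi; case: cid.
Qed.

(** Zorn's lemma gives a maximal partial bijection. It exhausts one of the two sides, since a pair
    of unmatched points could otherwise be added. *)
Lemma embeds_total (X Y : Type) : embeds X Y \/ embeds Y X.
Proof.
pose P (R : set (X * Y)) :=
  forall x y x' y', R (x, y) -> R (x', y') -> x = x' <-> y = y'.
have [F FP Ftot|R [PR Rmax]] := @Zorn_bigcup (X * Y) P.
  move=> x y x' y' [R1 FR1 h1] [R2 FR2 h2].
  by have [s|s] := Ftot _ _ FR1 FR2; [apply: (FP _ FR2)|apply: (FP _ FR1)] => //;
    apply: s.
have [Xt|] := pselect (forall x, exists y, R (x, y)).
  left; have [f fR] := choice Xt; exists f => x x' fxx.
  exact: (PR _ _ _ _ (fR x) (fR x')).2.
move=> /existsNP[x0 nx0].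
have [Yt|] := pselect (forall y, exists x, R (x, y)).
  right; have [f fR] := choice Yt; exists f => x x' fxx.
  exact: (PR _ _ _ _ (fR x) (fR x')).1.
move=> /existsNP[y0 ny0].
exfalso; apply: (Rmax (R `|` [set (x0, y0)])).
  split; first by move=> z; left.
  by move=> sub; apply: nx0; exists y0; apply: sub; right.
move=> x y x' y' [r|[-> ->]] [r'|[-> ->]].
- exact: PR.
- by split=> e; subst; [case: nx0; exists y|case: ny0; exists x].
- by split=> e; subst; [case: nx0; exists y'|case: ny0; exists x'].
- by [].
Qed.

(** * Arithmetic of infinite cardinals *)

Definition absorbing (Y : Type) : Prop := embeds nat Y /\ embeds (Y * Y) Y.

Section Absorbing.
Variable Y : Type.
Hypothesis absY : absorbing Y.

Lemma absorbing_prod (A B : Type) : embeds A Y -> embeds B Y -> embeds (A * B) Y.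
Proof. by move=> AY BY; apply: embeds_trans absY.2; exact: embeds_prod. Qed.

Lemma absorbing_count (A : countType) : embeds A Y.
Proof. exact: embeds_trans (embeds_count A) absY.1. Qed.

Lemma absorbing_sum (A B : Type) : embeds A Y -> embeds B Y -> embeds (A + B) Y.
Proof.
move=> AY BY; apply: (@embeds_trans (bool * Y)); last first.
  exact: (absorbing_prod (absorbing_count bool) (ex_intro _ id (@inj_id _))).
apply: (embeds_trans (embeds_sum AY BY)).
exists (fun z => match z with inl x => (true, x) | inr y => (false, y) end).
by case=> a [] b // [->].
Qed.

Lemma absorbing_option (A : Type) : embeds A Y -> embeds (option A) Y.
Proof.
move=> AY; apply: (embeds_trans _ (absorbing_sum AY (absorbing_count unit))).
by exists (fun z => if z is Some x then inl x else inr tt) => -[a|] [b|] // [->].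
Qed.

Lemma absorbing_seq (A : Type) : embeds A Y -> embeds (seq A) Y.
Proof.
move=> [f fi]; have [[g gi] [m mi]] := absY.
(* The length is coded separately because the fold alone does not show where a sequence ends. *)
pose enc := foldr (fun a y => m (f a, y)) (g 0%N).
exists (fun s => m (g (size s), enc s)) => s t /mi[/gi].
elim: s t => [|a s IH] [|b t] //= [st] /mi [/fi -> e].
by rewrite (IH t).
Qed.

End Absorbing.

Section Hessenberg.
Variable X : Type.
Implicit Type R : set (X * X * X).

Let dom R := [set x | exists z, R (x, x, z)].

(* R is the graph of an injection of D * D into an infinite D; the empty graph
   is included for the sake of the empty chain. *)
Let good R := [/\ forall x y z z', R (x, y, z) -> R (x, y, z') -> z = z',
  forall x y x' y' z, R (x, y, z) -> R (x', y', z) -> (x, y) = (x', y'),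
  forall x y, dom R x -> dom R y -> exists z, R (x, y, z),
  forall x y z, R (x, y, z) -> [/\ dom R x, dom R y & dom R z] &
  R = set0 \/ embeds nat {x | dom R x}].

Let good_bigcup (F : set (set (X * X * X))) : F `<=` good ->
  total_on F (fun A B => A `<=` B) -> good (\bigcup_(R in F) R).
Proof.
move=> Fg Ftot.
have two R1 R2 u v : F R1 -> F R2 -> R1 u -> R2 v ->
    exists R, [/\ F R, R u & R v].
  move=> F1 F2 h1 h2; have [s|s] := Ftot _ _ F1 F2.
    by exists R2; split=> //; exact: s.
  by exists R1; split=> //; exact: s.
have domS R x : F R -> dom R x -> dom (\bigcup_(R in F) R) x.
  by move=> FR [z Rz]; exists z, R.
split.
- move=> x y z z' [R1 F1 h1] [R2 F2 h2].
  have [R [FR Ru Rv]] := two _ _ _ _ F1 F2 h1 h2.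
  by have [h _ _ _ _] := Fg _ FR; exact: h Ru Rv.
- move=> x y x' y' z [R1 F1 h1] [R2 F2 h2].
  have [R [FR Ru Rv]] := two _ _ _ _ F1 F2 h1 h2.
  by have [_ h _ _ _] := Fg _ FR; exact: h Ru Rv.
- move=> x y [z [R1 F1 h1]] [z' [R2 F2 h2]].
  have [R [FR Ru Rv]] := two _ _ _ _ F1 F2 h1 h2.
  have [_ _ h _ _] := Fg _ FR; have [| |w Rw] := h x y; try by eexists; eassumption.
  by exists w, R.
- move=> x y z [R FR Rxyz]; have [_ _ _ h _] := Fg _ FR.
  by have [dx dy dz] := h _ _ _ Rxyz; split; exact: domS FR _.
- have [[R FR R0]|nR] := pselect (exists2 R, F R & R <> set0); last first.
    left; rewrite -subset0 => z [R FR Rz]; case: nR; exists R => // R0.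
    by rewrite R0 in Rz.
  right; have [_ _ _ _ [//|[f fi]]] := Fg _ FR.
  exists (fun n => exist _ (sval (f n)) (domS _ _ FR (svalP (f n)))).
  by move=> m n [] e; apply: fi; exact: sval_inj.
Qed.

Let good_nat : embeds nat X -> exists2 R, good R & R <> set0.
Proof.
move=> [f fi]; have [g gi] := embeds_count (nat * nat)%type.
pose R := [set z | exists i j, z = (f i, f j, f (g (i, j)))].
have domf i : dom R (f i) by exists (f (g (i, i))), i, i.
exists R; last by rewrite -subset0 => /(_ (f 0, f 0, f (g (0, 0)))); apply; exists 0, 0.
split.
- by move=> x y z z' [i [j [-> -> ->]]] [i' [j' [/fi -> /fi -> ->]]].
- by move=> x y x' y' z [i [j [-> -> ->]]] [i' [j' [-> -> /fi/gi[-> ->]]]].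
- move=> x y [z [i [_ [-> _ _]]]] [z' [i' [_ [-> _ _]]]].
  by exists (f (g (i, i'))), i, i'.
- by move=> x y z [i [j [-> -> ->]]]; split.
- right; exists (fun i => exist _ (f i) (domf i)).
  by move=> i j [] /fi.
Qed.

(** Hessenberg's theorem. Take a maximal injection of [D * D] into [D]. If the complement of [D]
    embeds in [D], so does [X]. Otherwise the complement contains a copy of [D], and the injection
    extends to the union of [D] and this copy, against maximality. *)
Theorem embeds_square : embeds nat X -> embeds (X * X) X.
Proof.
move=> natX; have [R [gR Rmax]] := Zorn_bigcup good_bigcup.
have R0 : R <> set0.
  move=> R0; have [R' gR' R'0] := good_nat natX; apply: (Rmax R') => //.
  rewrite R0; split=> //; first by rewrite subset0.
have [Rfun Rinj Rtot Rcl [//|natD]] := gR.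
pose D := {x | dom R x}; rewrite -/D in natD.
have absD : absorbing D.
  split=> //; have Rz (z : D * D) : exists w : D, R (sval z.1, sval z.2, sval w).
    case: z => -[x dx] [y dy] /=; have [z Rz] := Rtot _ _ dx dy.
    by have [_ _ dz] := Rcl _ _ _ Rz; exists (exist _ z dz).
  have [f fR] := choice Rz; exists f => -[[a da] [b db]] [[c dc] [d dd]] e.
  have h1 := fR (exist _ a da, exist _ b db).
  have h2 := fR (exist _ c dc, exist _ d dd); rewrite -e in h2.
  have [ac bd] := Rinj _ _ _ _ _ h1 h2.
  by congr pair; exact: sval_inj.
have DD : embeds D D by exists id.
have DX : embeds D X by exists sval; exact: sval_inj.
have [CD|[g gi]] := embeds_total {x | ~ dom R x} D.
  have XD : embeds X D.
    apply: embeds_trans (absorbing_sum absD DD CD).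
    exists (fun x => match pselect (dom R x) with
      left d => inl (exist _ x d) | right d => inr (exist _ x d) end).
    by move=> x y; case: pselect => d; case: pselect => d' // [].
  apply: embeds_trans DX; exact: (absorbing_prod absD XD XD).
exfalso.
(* [c] enumerates [D] (tag [false]) and its disjoint copy (tag [true]). The pairs that involve the
   copy will get their values in the copy. *)
pose c (z : bool * D) := if z.1 then sval (g z.2) else sval z.2.
have c_inj : injective c.
  move=> [[] u] [[] v] /= e.
  - by congr pair; exact/gi/sval_inj.
  - by case: (svalP (g u)); rewrite /c /= in e; rewrite e; exact: (svalP v).
  - by case: (svalP (g v)); rewrite /c /= in e; rewrite -e; exact: (svalP u).
  - by congr pair; exact: sval_inj.
have [h hi] : embeds ((bool * D) * (bool * D)) D.
  by apply: absorbing_prod => //; apply: absorbing_prod => //; exact: absorbing_count.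
pose N := [set w : X * X * X | exists2 z : (bool * D) * (bool * D),
  z.1.1 || z.2.1 & w = (c z.1, c z.2, sval (g (h z)))].
pose R' := R `|` N.
have domR' z : dom R' (c z).
  have [b|b] := boolP z.1.
    by exists (sval (g (h (z, z)))); right; exists (z, z); rewrite //= b.
  have [w Rw] : dom R (c z) by rewrite /c (negbTE b); exact: svalP.
  by exists w; left.
have domR x : dom R x -> exists2 d : D, sval d = x & x = c (false, d).
  by move=> dx; exists (exist _ x dx).
have RN x y z z1 z2 : R (x, y, z) -> (z1.1 || z2.1) -> (x, y) <> (c z1, c z2).
  move=> /Rcl[dx dy _] b [ex ey]; move: b.
  have [d _ e1] := domR _ dx; have [d' _ e2] := domR _ dy.
  by move: ex ey; rewrite e1 e2 => /c_inj <- /c_inj <-.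
have RNz x y z d : R (x, y, z) -> z <> sval (g d).
  by move=> /Rcl[_ _ dz] e; apply: (svalP (g d)); rewrite -e.
have ginj u v : sval (g u) = sval (g v) -> u = v.
  by move=> /sval_inj/gi.
have dom' x : dom R' x -> exists z, x = c z.
  move=> [z [Rz|[[z1 z2] _ [-> _ _]]]]; last by exists z1.
  have [d _ e] : exists2 d : D, sval d = x & x = c (false, d).
    by apply: domR; exists z.
  by exists (false, d).
apply: (Rmax R').
  split; first by move=> z; left.
  move=> sub; have [f fi] := natD; pose u := (true, f 0%N).
  have /sub /Rcl[du _ _] : R' (c u, c u, sval (g (h (u, u)))).
    by right; exists (u, u).
  exact: (svalP (g (f 0%N))).
split.
- move=> x y z z' [h1|[[z1 z2] b1 [-> -> ->]]] [h2|[[z3 z4] b2 [e1 e2 ->]]].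
  + exact: Rfun h1 h2.
  + by case: (RN _ _ _ _ _ h1 b2); rewrite e1 e2.
  + by case: (RN _ _ _ _ _ h2 b1).
  + by move: e1 e2 => /c_inj -> /c_inj ->.
- move=> x y x' y' z [h1|[[z1 z2] b1 [-> -> e]]] [h2|[[z3 z4] b2 [-> -> e']]].
  + exact: Rinj h1 h2.
  + by case: (RNz _ _ _ _ h1 e').
  + by case: (RNz _ _ _ _ h2 e).
  + by move: e'; rewrite e => /ginj/hi[-> ->].
- move=> x y /dom'[z1 ->] /dom'[z2 ->].
  have [b|] := boolP (z1.1 || z2.1).
    by exists (sval (g (h (z1, z2)))); right; exists (z1, z2).
  rewrite negb_or => /andP[b1 b2].
  have [||w Rw] := Rtot (c z1) (c z2).
  + by rewrite /c (negbTE b1); exact: svalP.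
  + by rewrite /c (negbTE b2); exact: svalP.
  by exists w; left.
- move=> x y z [/Rcl[/domR[? _ ->] /domR[? _ ->] /domR[? _ ->]]|[[z1 z2] _ [-> -> ->]]].
    by split; exact: domR'.
  by split; try exact: domR'; exact: (domR' (true, _)).
- right; have [f fi] := natD.
  by exists (fun n => exist _ _ (domR' (false, f n))) => m n [] /c_inj [] /fi.
Qed.

End Hessenberg.

Lemma absorbing_infinite (X : Type) : embeds nat X -> absorbing X.
Proof. by move=> h; split=> //; exact: embeds_square. Qed.

Local Notation cantor := (nat -> bool).

Lemma embeds_cantor_fun : embeds (nat -> cantor) cantor.
Proof.
exists (fun u k => if unpickle k is Some (i, j) then u i j else false) => u v uv.
apply/funext => i; apply/funext => j.
by have := congr1 (@^~ (pickle (i, j))) uv; rewrite pickleK.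
Qed.

Lemma absorbing_cantor : absorbing cantor.
Proof.
split; first by exists (fun n k => k == n) => m n /(congr1 (@^~ m)) /=;
  rewrite eqxx => /esym/eqP.
apply: embeds_trans embeds_cantor_fun.
exists (fun z n => if n is 0 then z.1 else z.2) => -[a b] [c d] e.
by have /= -> := congr1 (@^~ 0%N) e; have /= -> := congr1 (@^~ 1%N) e.
Qed.

(** * Sets of size less than the continuum *)

Definition small (X : Type) : Prop := ~ embeds cantor X.

Lemma small_embeds (X Y : Type) : embeds X Y -> small Y -> small X.
Proof. by move=> XY sY cX; apply: sY; exact: embeds_trans XY. Qed.

(** A form of König's theorem: the continuum is not a countable union of smaller sets. A point of
    [cantor] codes countably many sections. Some [z i] is not the [i]-th section of any member of
    [R i], and the point with the sections [z i] lies in no [R i]. *)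
Lemma konig (I : countType) (R : I -> set cantor) :
  (forall i, small {r | R i r}) -> exists r, forall i, ~ R i r.
Proof.
move=> sR; pose sec (r : cantor) (i : I) : cantor := fun n => r (pickle (pickle i, n)).
have /choice[z zP] i : exists z, forall r, R i r -> sec r i <> z.
  apply: contrapT => nz; apply: (sR i).
  have /choice[f fP] (z : cantor) : exists r : {r | R i r}, sec (sval r) i = z.
    apply: contrapT => nr; apply: nz; exists z => r Rr e; apply: nr.
    by exists (exist _ r Rr).
  by exists f => z z' e; rewrite -(fP z) -(fP z') e.
pose r : cantor := fun k => if unpickle k is Some (a, n) then
  (if unpickle a is Some i then z i n else false) else false.
exists r => i /zP; apply; apply/funext => n.
by rewrite /sec /r !pickleK.
Qed.

Lemma small_count (X : countType) : small X.
Proof.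
move=> [f fi]; have [r|r] := @konig X (fun x r => f r = x).
  move=> [g gi]; have /gi : g xpredT = g xpred0.
    by apply/sval_inj/fi; rewrite (svalP (g xpredT)) (svalP (g xpred0)).
  by move=> /(congr1 (@^~ 0%N)).
by move=> /(_ (f r)).
Qed.

Lemma small_sum (X Y : Type) : small X -> small Y -> small (X + Y).
Proof.
move=> sX sY [f fi].
have [b|r rP] := @konig bool (fun b => if b then [set r | exists x, f r = inl x]
    else [set r | exists y, f r = inr y]).
  case: b; [apply: small_embeds sX|apply: small_embeds sY].
    have /choice[g gP] (r : {r | exists x, f r = inl x}) : exists x, f (sval r) = inl x.
      by case: r.
    by exists g => u v e; apply/sval_inj/fi; rewrite !gP e.
  have /choice[g gP] (r : {r | exists x, f r = inr x}) : exists x, f (sval r) = inr x.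
    by case: r.
  by exists g => u v e; apply/sval_inj/fi; rewrite !gP e.
by case fr: (f r) => [x|y]; [apply: (rP true); exists x|apply: (rP false); exists y].
Qed.

(** * Transfinite recursion and well-orders *)

(** Transfinite recursion with choices. The second hypothesis says that [good t x y] reads [x] only
    below [t], so [ext] may fill the remaining values with [b0]. *)
Lemma wf_choice (T B : Type) (lt : T -> T -> Prop) (b0 : B)
    (good : T -> (T -> B) -> B -> Prop) :
  well_founded lt ->
  (forall t x x' y, (forall t', lt t' t -> x t' = x' t') -> good t x y -> good t x' y) ->
  (forall t x, (forall t', lt t' t -> good t' x (x t')) -> exists y, good t x y) ->
  exists x, forall t, good t x (x t).
Proof.
move=> wf loc ex.
pose ext t (rec : forall t', lt t' t -> B) t' :=
  if pselect (lt t' t) is left h then rec t' h else b0.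
pose F t rec := if pselect (exists y, good t (ext t rec) y) is left e
  then projT1 (cid e) else b0.
pose x := Fix wf (fun=> B) F.
have xE t : x t = F t (fun t' _ => x t').
  rewrite /x Fix_eq // => s f g fg; congr (F s _).
  by apply: functional_extensionality_dep => t'; apply/funext.
have extE t t' : lt t' t -> ext t (fun t' _ => x t') t' = x t'.
  by rewrite /ext; case: pselect.
exists x; elim/(well_founded_ind wf) => t IH.
rewrite xE /F; case: pselect => [e|[]].
  by case: cid => y gy; apply: loc gy; exact: extE.
have [y gy] := ex t x IH; exists y; apply: loc gy => t' h.
by rewrite extE.
Qed.

Definition strict (T : Type) (R : rel T) (x y : T) : Prop := R x y /\ x <> y.

Lemma well_order_strict (T : eqType) (R : rel T) (lt := strict R) : well_order R ->
  [/\ well_founded lt, forall x y z, lt x y -> lt y z -> lt x z &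
      forall x y, [\/ lt x y, x = y | lt y x]].
Proof.
move=> Rwo; have Rch : wo_chain R predT by move=> A _; exact: Rwo.
have Rtot x y : R x y || R y x by exact: (wo_chainW Rch).
have Ranti x y : R x y -> R y x -> x = y.
  by move=> xy yx; apply: (wo_chain_antisymmetric Rch) => //; rewrite xy.
have minP (A : set T) : A !=set0 -> exists2 x, A x & forall y, A y -> R x y.
  move=> [a Aa]; have [|x [[/asboolP Ax xm] _]] := Rwo [pred x | `[< A x >]].
    by exists a; apply/asboolP.
  by exists x => // y Ay; apply: xm; apply/asboolP.
have tri x y : [\/ lt x y, x = y | lt y x].
  have [->|xy] := pselect (x = y); first exact: Or32.
  have /orP[h|h] := Rtot x y; [apply: Or31|apply: Or33]; split=> //.
  by move=> e; apply: xy.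
split; last exact: tri.
- move=> x; apply: contrapT => nx.
  have [z nz zm] := minP [set x | ~ Acc lt x] (ex_intro _ x nx).
  apply: nz; constructor => y [yz neq]; apply: contrapT => ny.
  by apply: neq; exact: Ranti (zm _ ny).
- move=> x y z [xy nxy] [yz nyz].
  have [w /= we wm] := minP [set w | [\/ w = x, w = y | w = z]]
    (ex_intro _ x (Or31 _ _ erefl)).
  case: we => e; subst w.
  + split; first exact: wm (Or33 _ _ erefl).
    by move=> e; subst z; apply: nxy; exact: Ranti.
  + by case: nxy; apply: Ranti => //; exact: wm (Or31 _ _ erefl).
  + by case: nyz; apply: Ranti => //; exact: wm (Or32 _ _ erefl).
Qed.

(** In a well-order of [cantor], keep the points whose initial segments are small. *)
Lemma exists_continuum_order : exists (T : Type) (lt : T -> T -> Prop),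
  [/\ well_founded lt, forall x y z, lt x y -> lt y z -> lt x z,
      forall x y, [\/ lt x y, x = y | lt y x],
      forall t, small {t' | lt t' t} &
      embeds cantor T /\ embeds T cantor].
Proof.
have [R Rwo] := well_ordering_principle (cantor : eqType).
have [wf trans tri] := well_order_strict Rwo; set lt := strict R in wf trans tri.
pose p x := small {y | lt y x}.
exists {x | p x}, (fun x y => lt (sval x) (sval y)); split.
- move=> [x px]; elim/(well_founded_ind wf): x px => x IH px.
  by constructor=> -[y py] /= yx; exact: IH.
- by move=> x y z; exact: trans.
- move=> x y; case: (tri (sval x) (sval y)) => h; [exact: Or31| |exact: Or33].
  by apply: Or32; exact: sval_inj.
- move=> [x px]; apply: small_embeds (px).
  exists (fun y : {t' : {x | p x} | lt (sval t') x} => exist _ (sval (sval y)) (svalP y)).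
  by move=> y z [] e; apply/sval_inj/sval_inj.
- split; last by exists sval; exact: sval_inj.
  have [allp|] := pselect (forall x, p x).
    by exists (fun x => exist _ x (allp x)) => x y [].
  move=> /existsNP[x0]; elim/(well_founded_ind wf): x0 => x IH npx.
  (* By induction [x] may be the least point whose segment is not small. All points of that segment
     are then kept, and there are continuum many of them. *)
  have [|nall] := pselect (exists2 y, lt y x & ~ p y).
    by move=> [y yx npy]; exact: IH npy.
  have allp y : lt y x -> p y by move=> yx; apply: contrapT => npy; apply: nall; exists y.
  have [f fi] : embeds cantor {y | lt y x} by exact: contrapT.
  exists (fun r => exist _ (sval (f r)) (allp _ (svalP (f r)))) => r r' [] e.
  exact/fi/sval_inj.
Qed.

(** Initial segments of omega_1 are countable, so the recursion always finds a value in the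
    uncountable [Y] that has not been used. *)
Lemma omega1_embeds (W Y : Type) : is_omega1 W -> ~ embeds Y nat -> embeds W Y.
Proof.
move=> [R [Rwo _ Rc]] nY; pose E : eqType := {classic W}.
have [wf _ tri] := @well_order_strict E R Rwo; set lt := strict _ in wf tri.
have [y0 _] : exists y : Y, True.
  apply: contrapT => n; apply: nY.
  by exists (fun y => False_rect nat (n (ex_intro _ y I))) => y; case: n; exists y.
have [||x xP] := @wf_choice W Y lt y0 (fun t x y => forall t', lt t' t -> x t' <> y)
  wf.
- by move=> t x x' y xx h t' t't; rewrite -xx//; exact: h.
- move=> t x _; apply: contrapT => n; apply: nY.
  have /choice[g gP] (y : Y) : exists t', lt t' t /\ x t' = y.
    apply: contrapT => n'; apply: n; exists y => t' t't e; apply: n'.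
    by exists t'.
  have /countable_injP[f fi] := Rc t.
  exists (f \o g) => y y' /fi e; rewrite -(gP y).2 -(gP y').2 e//; apply/mem_set.
    exact: (gP y).1.
  exact: (gP y').1.
- exists x => t t' e; case: (tri t t') => // h; last by case: (xP _ _ h).
  by case: (xP _ _ h).
Qed.

(** * Ultrafilters and limits in a group without convergent sequences *)

Local Open Scope ring_scope.

Definition unbounded (A : set nat) : Prop := forall N, exists2 n, (N <= n)%N & A n.

Lemma infinite_unbounded (A : set nat) : infinite_set A <-> unbounded A.
Proof.
split=> [Ainf N|Aub].
  apply: contrapT => nA; apply: Ainf; apply: (@sub_finite_set _ _ `I_N).
    by move=> n An /=; rewrite ltnNge; apply/negP => Nn; apply: nA; exists n.
  exact: finite_II.
move=> /finite_seqP[s As]; have [n nlt] := Aub (\max_(i <- s) i).+1.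
rewrite As /= => ns; move: nlt; rewrite ltnNge => /negP; apply.
exact: (@leq_bigmax_seq _ s xpredT id n ns isT).
Qed.

Lemma unboundedS (A B : set nat) : A `<=` B -> unbounded A -> unbounded B.
Proof. by move=> AB Aub N; have [n Nn /AB] := Aub N; exists n. Qed.

Definition free_ultra (p : set_system nat) : Prop :=
  UltraFilter p /\ forall N, p [set n | (N <= n)%N].

Lemma free_unbounded p A : free_ultra p -> p A -> unbounded A.
Proof.
move=> [pU pN] pA N.
by have [n [An Nn]] := filter_ex (filterI pA (pN N)); exists n.
Qed.

Lemma exists_free_ultra (F : set_system nat) : Filter F ->
  (forall A, F A -> unbounded A) -> exists2 p, free_ultra p & F `<=` p.
Proof.
move=> FF Fub; pose G := [set A | exists2 B, F B &
  exists N, B `&` [set n | (N <= n)%N] `<=` A].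
have GF : ProperFilter G.
  apply: Build_ProperFilter_ex.
    by move=> A [B FB [N BNA]]; have [n Nn Bn] := Fub _ FB N; exists n; exact: BNA.
  split.
  - by exists setT; [exact: filterT|exists 0%N].
  - move=> A A' [B FB [N BNA]] [B' FB' [N' BNA']].
    exists (B `&` B'); first exact: filterI.
    exists (maxn N N') => n [[Bn Bn']] /=; rewrite geq_max => /andP[Nn Nn'].
    by split; [exact: BNA|exact: BNA'].
  - move=> A A' AA' [B FB [N BNA]]; exists B => //; exists N.
    exact: subset_trans AA'.
have [p [pU Gp]] := ultraFilterLemma GF; exists p.
  split=> // N; apply: Gp; exists setT; first exact: filterT.
  by exists N => n [].
by move=> A FA; apply: Gp; exists A => //; exists 0%N => n [].
Qed.

Lemma ultra_not (p : set_system nat) (A : set nat) : UltraFilter p -> ~ p A -> p (~` A).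
Proof. by move=> pU npA; have [] := in_ultra_setVsetC A pU. Qed.

Lemma ultra_fin (F : finType) (p : set_system nat) (f : nat -> F) :
  UltraFilter p -> exists a, p [set n | f n = a].
Proof.
move=> pU; apply: contrapT => na.
suff H (s : seq F) : p [set n | f n \notin s].
  by have [n /=] := filter_ex (H (enum F)); rewrite mem_enum.
elim: s => [|a s IH]; first by apply: filterS (@filterT _ p _).
have /(filterI IH) : p (~` [set n | f n = a]).
  by apply: ultra_not => pa; apply: na; exists a.
by apply: filterS => n [/= ns /eqP/negbTE na']; rewrite inE na'.
Qed.

Section TopologicalGroup.
Variable H : topologicalZmodType.

Lemma cvg_sum (I : Type) (p : set_system nat) (w : seq I) (s : nat -> I -> H) (x : I -> H) :
  Filter p -> (forall j, (fun n => s n j) @ p --> x j) ->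
  (fun n => \sum_(j <- w) s n j) @ p --> \sum_(j <- w) x j.
Proof.
move=> pF sx; elim: w => [|j w IH].
  rewrite big_nil; under eq_fun do rewrite big_nil; exact: cvg_cst.
rewrite big_cons; under eq_fun do rewrite big_cons.
apply: (@continuous2_cvg _ _ _ _ _ pF _ _ +%R) (sx j) IH.
exact: (@add_continuous H (x j, _)).
Qed.

(** Regularity of a topological group: choose [V] and [N] with [V - N] inside [U]. A point [z] of
    the closure of [V] equals [v - (v - z)] for some [v] in [V] with [v - z] in [N]. *)
Lemma nbhs_closure (y : H) (U : set H) : nbhs y U ->
  exists2 V, nbhs y V & closure V `<=` U.
Proof.
move=> yU; have : nbhs (y, 0 : H) [set z | U (z.1 - z.2)].
  by apply: sub_continuous => /=; rewrite subr0.
move=> [[V N] /= [yV N0] VN]; exists V => // z Vz.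
have : nbhs z [set b | N (b - z)].
  have c : (fun b => b - z) @ z --> z - z.
    apply: (@continuous2_cvg _ _ _ _ _ _ _ _ (fun a b => a - b)).
    - exact: (@sub_continuous H (z, z)).
    - exact: cvg_id.
    - exact: cvg_cst.
  by apply: c; rewrite subrr.
move=> /Vz[v [Vv Nv]]; have := VN (v, v - z) (conj Vv Nv).
by rewrite /= opprB addrC subrK.
Qed.

(** Countable compactness of a power, stated for one family: there are joint limits along a free
    ultrafilter inside any prescribed infinite index set. In this form it survives the passage to
    subsequences. *)
Definition always_clusters (J : Type) (s : nat -> J -> H) : Prop :=
  forall B, unbounded B -> exists p (x : J -> H),
    [/\ free_ultra p, p B & forall j, (fun n => s n j) @ p --> x j].

Definition constant_on (g : nat -> H) (A : set nat) : Prop :=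
  exists v, forall n, A n -> g n = v.

Definition separated (g : nat -> H) (A B : set nat) : Prop :=
  forall p q (y : H), free_ultra p -> free_ultra q -> p A -> q B ->
    g @ p --> y -> ~ (g @ q --> y).

Hypothesis nconv : no_nontrivial_convergent_sequences H.

(** Let [y] be a limit of [g] along [B]. If [g] leaves some neighbourhood of [y] infinitely often on
    [A], regularity separates those indices from the ones in [B] with values near [y]. Otherwise [g]
    converges to [y] along [A], hence is constant on an infinite subset. *)
Lemma split_one (g : nat -> H) (A B : set nat) :
  always_clusters (fun n (_ : unit) => g n) -> unbounded A -> unbounded B ->
  exists A' B', [/\ A' `<=` A, B' `<=` B, unbounded A', unbounded B' &
    constant_on g A' \/ separated g A' B'].
Proof.
move=> gacc Aub Bub; have [q [y' [qfree qB /(_ tt)]]] := gacc _ Bub.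
set y := y' tt => gy.
have [[U yU AU]|nU] := pselect (exists2 U, nbhs y U & unbounded [set n | A n /\ ~ U (g n)]).
  have [V yV VU] := nbhs_closure (nbhs_interior yU).
  exists [set n | A n /\ ~ U (g n)], (B `&` g @^-1` V); split=> //.
  - by move=> n [].
  - apply: (free_unbounded qfree); have [qU _] := qfree.
    by apply: filterI => //; exact: gy.
  right=> p1 p2 z [p1U _] [p2U _] p1A p2B g1 g2.
  have /VU zU : closure V z.
    move=> W zW; have p2W : p2 (g @^-1` W) := g2 _ zW.
    have [n [Wn [_ Vn]]] := filter_ex (filterI p2W p2B).
    by exists (g n).
  have p1U' : p1 (g @^-1` U) := g1 _ zU.
  have [n [Un [_ nUn]]] := filter_ex (filterI p1U' p1A).
  exact: nUn.
have /choice[u uP] n : exists m, (n <= m)%N /\ A m.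
  by have [m nm Am] := Aub n; exists m.
have guy : (g \o u) @ \oo --> y.
  move=> U yU; have [N NP] : exists N, forall n, (N <= n)%N -> A n -> U (g n).
    apply: contrapT => nN; apply: nU; exists U => // N.
    apply: contrapT => nN'; apply: nN; exists N => n Nn An.
    by apply: contrapT => nUn; apply: nN'; exists n.
  exists N => // n /= Nn; have [nu Au] := uP n.
  by apply: NP => //; exact: leq_trans nu.
have [c [N _ NP]] := nconv guy.
exists [set n | A n /\ g n = c], B; split=> //.
- by move=> n [].
- move=> M; have [mu Au] := uP (maxn M N); exists (u (maxn M N)).
    by apply: leq_trans mu; exact: leq_maxl.
  by split=> //; apply: NP; exact: leq_maxr.
- by left; exists c => n [].
Qed.

Lemma separatedS (g : nat -> H) (A B A' B' : set nat) :
  A' `<=` A -> B' `<=` B -> separated g A B -> separated g A' B'.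
Proof.
move=> AA BB sAB p q y pf qf pA qB; apply: sAB => //.
  by case: pf => ? _; exact: filterS pA.
by case: qf => ? _; exact: filterS qB.
Qed.

Lemma split_many (g : nat -> nat -> H) (m : nat) (A : set nat) :
  (forall k, always_clusters (fun n (_ : unit) => g k n)) -> unbounded A ->
  exists A' B', [/\ A' `<=` A, B' `<=` A, unbounded A', unbounded B' &
    forall k, (k < m)%N -> constant_on (g k) A' \/ separated (g k) A' B'].
Proof.
move=> gacc Aub; elim: m => [|m [A1 [B1 [A1A B1A A1u B1u IH]]]]; first by exists A, A; split.
have [A2 [B2 [A21 B21 A2u B2u sm]]] := split_one (gacc m) A1u B1u.
exists A2, B2; split=> //; try exact: subset_trans A1A; try exact: subset_trans B1A.
move=> k; rewrite ltnS leq_eqVlt => /predU1P[->//|/IH[[v vP]|sk]].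
  by left; exists v => n /A21; exact: vP.
by right; exact: separatedS sk.
Qed.

(** The Cantor tree of index sets. [spl] also receives the level, which tells how many sequences the
    split has to treat. *)
Fixpoint node (spl : nat * set nat -> set nat * set nat) (t : seq bool) : set nat :=
  if t is b :: t' then
    let w := spl (size t', node spl t') in if b then w.1 else w.2
  else setT.

(* Reversed, so that extending a prefix is a cons. *)
Fixpoint prefix_rev (r : cantor) (n : nat) : seq bool :=
  if n is m.+1 then r m :: prefix_rev r m else [::].

Lemma size_prefix_rev r n : size (prefix_rev r n) = n.
Proof. by elim: n => //= n ->. Qed.

Lemma eq_prefix_rev r r' n :
  prefix_rev r n = prefix_rev r' n <-> forall m, (m < n)%N -> r m = r' m.
Proof.
elim: n => [|n [IH1 IH2]] //=; split=> [[rn /IH1 h] m|h].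
  by rewrite ltnS leq_eqVlt => /predU1P[->//|]; exact: h.
by rewrite h// IH2// => m mn; rewrite h// ltnW.
Qed.

(* Continuum many branches of a Cantor tree of subsequences: distinct branches
   give distinct limits of every nonconstant sum from some level on, so fewer
   than continuum many values can be avoided. *)
Theorem avoiding_limit (s : nat -> nat -> H) (D : set H) :
  always_clusters s -> small {h | D h} ->
  exists p (x : nat -> H), [/\ free_ultra p, forall j, (fun n => s n j) @ p --> x j &
    forall w : seq nat, (exists v, p [set n | \sum_(j <- w) s n j = v]) \/
      ~ D (\sum_(j <- w) x j)].
Proof.
move=> sacc Dsmall.
pose word k : seq nat := if unpickle k is Some w then w else [::].
pose g k n := \sum_(j <- word k) s n j.
have gacc k : always_clusters (fun n (_ : unit) => g k n).
  move=> B /sacc[p [x [pf pB sx]]]; exists p, (fun=> \sum_(j <- word k) x j); split=> // _.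
  by apply: cvg_sum sx; case: pf => ? _; exact: ultra_proper.
have /choice[spl splP] (z : nat * set nat) : exists z', unbounded z.2 ->
    [/\ z'.1 `<=` z.2, z'.2 `<=` z.2, unbounded z'.1, unbounded z'.2 &
     forall k, (k < z.1)%N -> constant_on (g k) z'.1 \/ separated (g k) z'.1 z'.2].
  have [zu|zu] := pselect (unbounded z.2); last by exists (z.2, z.2).
  by have [A' [B' ?]] := split_many z.1 gacc zu; exists (A', B').
have nodeu t : unbounded (node spl t).
  elim: t => [|b t IH] /=; first by move=> N; exists N.
  by have [_ _] := splP (size t, node spl t) IH; case: b.
have nodeS r m n : (m <= n)%N ->
    node spl (prefix_rev r n) `<=` node spl (prefix_rev r m).
  elim: n => [|n IH]; first by rewrite leqn0 => /eqP ->.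
  rewrite leq_eqVlt => /predU1P[->//|/IH]; apply: subset_trans => /=.
  have [s1 s2 _ _ _] := splP (size (prefix_rev r n), _) (nodeu (prefix_rev r n)).
  by case: (r n).
have /choice[px pxP] (r : cantor) : exists px : set_system nat * (nat -> H),
    [/\ free_ultra px.1, forall n, px.1 (node spl (prefix_rev r n)) &
        forall j, (fun n => s n j) @ px.1 --> px.2 j].
  (* The range of [b] is almost contained in every node along [r], so a free ultrafilter containing
     it contains all these nodes. *)
  have /choice[b bP] n : exists m, (n <= m)%N /\ node spl (prefix_rev r n) m.
    by have [m nm Am] := nodeu (prefix_rev r n) n; exists m.
  have [|p [x [pf pB sx]]] := sacc (range b).
    by move=> N; exists (b N); [case: (bP N)|exists N].
  exists (p, x); split=> //= n; have [pU pN] := pf.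
  apply: filterS (filterI pB (pN (\max_(m < n) b m).+1)) => _ [[m _ <-] /= mb].
  have [mn|nm] := ltnP m n; last exact: (nodeS _ _ _ nm _ (bP m).2).
  by move: mb; rewrite ltnNge (@leq_bigmax _ (fun i : 'I_n => b i) (Ordinal mn)).
pose val r w := \sum_(j <- w) (px r).2 j.
have gval r w : g (pickle w) @ (px r).1 --> val r w.
  have [[pU _] _ sx] := pxP r; rewrite /g /word pickleK.
  by apply: cvg_sum sx; exact: ultra_proper.
(* The index fixes the first [(pickle i.1).+1] bits. Two branches in one bad set thus first differ
   at a level whose split treats the word [i.1]. Their limits are then distinct, and the bad set
   embeds in [D]. *)
pose bad (i : seq nat * seq bool) (r : cantor) :=
  [/\ size i.2 = (pickle i.1).+1, prefix_rev r (pickle i.1).+1 = i.2, D (val r i.1) &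
      forall n, ~ constant_on (g (pickle i.1)) (node spl (prefix_rev r n))].
have valN i r r' n : bad i r -> bad i r' -> (pickle i.1 < n)%N ->
    prefix_rev r n = prefix_rev r' n -> r n -> r' n = false -> val r i.1 <> val r' i.1.
  move=> [_ _ _ nc] _ kn rr' rn r'n e.
  have [_ _ _ _] := splP (size (prefix_rev r n), _) (nodeu (prefix_rev r n)).
  rewrite size_prefix_rev => /(_ _ kn)[|sep].
    by have := nc n.+1; rewrite /= rn size_prefix_rev.
  have [pf pn _] := pxP r; have [pf' pn' _] := pxP r'.
  apply: (sep _ _ (val r i.1) pf pf').
  - by have := pn n.+1; rewrite /= rn size_prefix_rev.
  - by have := pn' n.+1; rewrite /= r'n -rr' size_prefix_rev.
  - exact: gval.
  - by rewrite e; exact: gval.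
have [i|r rP] := @konig (seq nat * seq bool)%type bad.
  apply: small_embeds Dsmall.
  have Dval (r : {r | bad i r}) : D (val (sval r) i.1) by case: r => r [].
  exists (fun r => exist _ (val (sval r) i.1) (Dval r)).
  move=> [r br] [r' br'] [] /= e; apply: sval_inj => /=; apply: contrapT => rr'.
  have nr : exists n, r n != r' n.
    apply: contrapT => nn; apply: rr'; apply/funext => n; apply/eqP.
    by apply: contrapT => /negP ne; apply: nn; exists n.
  case: (ex_minnP nr) => n ne nmin.
  have lt_eq m : (m < n)%N -> r m = r' m.
    by move=> mn; apply/eqP; apply: contraTT mn => /nmin; rewrite -leqNgt.
  have kn : (pickle i.1 < n)%N.
    rewrite ltnNge; apply/negP => nk; move: ne; apply/negP; rewrite negbK; apply/eqP.
    have [_ h _ _] := br; have [_ h' _ _] := br'.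
    by apply: (eq_prefix_rev r r' (pickle i.1).+1).1; rewrite ?h ?h' ?ltnS.
  have pr : prefix_rev r n = prefix_rev r' n by apply/eq_prefix_rev.
  have [rn|rn] := boolP (r n).
    by apply: (valN i r r' n) => //; move: ne; rewrite rn; case: (r' n).
  by apply: (valN i r' r n) => //; [move: ne; rewrite (negbTE rn); case: (r' n)|exact/negbTE].
exists (px r).1, (px r).2; have [pf pn sx] := pxP r; split=> // w.
have [Dw|] := pselect (D (val r w)); last by right.
left; have [[n [v vP]]|nc] := pselect (exists n,
    constant_on (g (pickle w)) (node spl (prefix_rev r n))).
  exists v; have [pU _] := pf; apply: filterS (pn n) => m /vP.
  by rewrite /g /word pickleK.
case: (rP (w, prefix_rev r (pickle w).+1)); split=> //=.
  by rewrite size_prefix_rev.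
by move=> n cn; apply: nc; exists n.
Qed.

End TopologicalGroup.

(** * Linear relations *)

Lemma card_embeds_ord (K : Type) (m : nat) : ~ embeds K 'I_m -> embeds 'I_m.+1 K.
Proof.
move=> nK; have [//|[f fi]] := embeds_total 'I_m.+1 K.
have [fsurj|] := pselect (forall a, exists i, f i = a).
  have [g gP] := choice fsurj; exists g => a b gab.
  by rewrite -(gP a) -(gP b) gab.
move=> /existsNP[a na]; exfalso; apply: nK.
have /choice[g gP] i : exists j, f i = lift a j.
  case: (unliftP a (f i)) => [j ->|fa]; first by exists j.
  by case: na; exists i.
by exists g => i j gij; apply: fi; rewrite !gP gij.
Qed.

Section Relation.
Variables (P : nat) (V : zmodType).
Hypothesis prP : prime P.
Hypothesis VP : of_order P V.

Lemma mulrn_Fp_eq0 (x : V) (n : nat) : n%:R = 0 :> 'F_P -> x *+ n = 0.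
Proof.
move=> /eqP; rewrite -(dvdn_pcharf (pchar_Fp prP)) => /dvdnP[q ->].
by rewrite mulnC mulrnA VP mul0rn.
Qed.

Lemma sum_count (js w : seq nat) (x : nat -> V) : uniq js ->
  (forall j, j \in w -> x j != 0 -> j \in js) ->
  \sum_(j <- w) x j = \sum_(j <- js) x j *+ count_mem j w.
Proof.
move=> ujs; elim: w => [|a w IH] xjs.
  by rewrite big_nil big1 // => j _; rewrite mulr0n.
rewrite big_cons IH => [|j jw]; last by apply: xjs; rewrite inE jw orbT.
under [RHS]eq_bigr do rewrite /= mulrnDr.
rewrite big_split /=; congr (_ + _).
have [/eqP xa0|/(xjs _ (mem_head _ _)) ajs] := boolP (x a == 0).
  by rewrite xa0 big1 // => j _; case: eqP => [<-|_]; rewrite ?xa0 ?mul0rn ?mulr0n.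
rewrite (big_rem a) //= eqxx mulr1n big_seq big1 ?addr0 // => j.
by rewrite mem_rem_uniq // inE => /andP[/negbTE + _]; rewrite eq_sym => ->; rewrite mulr0n.
Qed.

Lemma mulrn_Fp (x : V) (m n : nat) : m%:R = n%:R :> 'F_P -> x *+ m = x *+ n.
Proof.
move=> mn; apply: (addIr (x *+ (n * P.-1))); rewrite -!mulrnDr.
have nP : (n + n * P.-1 = n * P)%N by rewrite -mulnS prednK ?prime_gt0.
by rewrite !mulrn_Fp_eq0 // !natrD ?mn -natrD nP natrM (pcharf0 (pchar_Fp prP)) mulr0.
Qed.

(** If infinitely many [x j] are nonzero, [K] is uncountable while words are countable, so two
    indices share a word and their difference is a relation. Otherwise [K] has more elements than
    there are nonzero [x j], and the matrix of multiplicities has more rows than columns. *)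
Lemma linear_relation (K : Type) (x : nat -> V) (w : K -> seq nat) :
  ~ embeds K {j | x j <> 0} ->
  exists m (k : 'I_m -> K) (c : 'I_m -> 'F_P),
    [/\ injective k, exists i, c i != 0 &
        \sum_i (\sum_(j <- w (k i)) x j) *+ c i = 0].
Proof.
move=> nK; have [Jinf|Jfin] := pselect (embeds nat {j | x j <> 0}).
  have ncK : ~ embeds K (seq nat).
    by move=> [f fi]; apply: nK; apply: embeds_trans Jinf;
       apply: (@embeds_trans (seq nat)); [exists f|exact: embeds_count].
  have [i [i' [ii' wii']]] : exists i i', i <> i' /\ w i = w i'.
    apply: contrapT => n; apply: ncK; exists w => i i' e; apply: contrapT => ii'.
    by apply: n; exists i, i'.
  have [c1 [c2 [c10 c12]]] : exists c1 c2 : 'F_P, c1 != 0 /\ c1 + c2 = 0.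
    by exists 1, (-1); rewrite oner_eq0 subrr.
  exists 2%N, (fun a => if a == ord0 then i else i'),
    (fun a => if a == ord0 then c1 else c2); split.
  - by move=> [[|[|//]] ?] [[|[|//]] ?] //= e; try exact: val_inj; case: ii'.
  - by exists ord0; rewrite eqxx.
  rewrite !big_ord_recl big_ord0 /= -wii' addr0 -mulrnDr.
  by apply: mulrn_Fp_eq0; rewrite natrD !natr_Zp c12.
have [N xN] : exists N, forall j, (N <= j)%N -> x j = 0.
  apply: contrapT => nN; apply: Jfin.
  have Jub : unbounded [set j | x j <> 0].
    move=> N; apply: contrapT => n; apply: nN; exists N => j Nj.
    by apply: contrapT => xj; apply: n; exists j.
  have /infiniteP/card_leP[f] := (infinite_unbounded _).2 Jub.
  exists (fun n => exist _ (sval (f (SigSub (mem_setT n))))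
    (set_mem (svalP (f (SigSub (mem_setT n)))))) => n n' [] e.
  have /(congr1 sval) // : SigSub (mem_setT n) = SigSub (mem_setT n') :> [set: nat].
  by apply: 'inj_f; rewrite ?inE //; exact: val_inj.
pose js := [seq j <- iota 0 N | x j != 0].
have ujs : uniq js by rewrite filter_uniq // iota_uniq.
have xjs j : x j != 0 -> j \in js.
  move=> xj; rewrite mem_filter xj mem_iota /= add0n ltnNge.
  by apply: contra xj => /xN ->.
have nKm : ~ embeds K 'I_(size js).
  move=> Km; apply: nK; apply: embeds_trans Km _.
  have jsP (a : 'I_(size js)) : x (nth 0%N js a) <> 0.
    by apply/eqP; have := mem_nth 0%N (ltn_ord a); rewrite mem_filter => /andP[].
  exists (fun a : 'I_(size js) => exist _ (nth 0%N js a) (jsP a)) => a b [] e.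
  by apply/val_inj/eqP; rewrite -(nth_uniq 0%N (ltn_ord a) (ltn_ord b) ujs) e.
have [k ki] := card_embeds_ord nKm.
pose M : 'M['F_P]_((size js).+1, size js) :=
  \matrix_(i, a) (count_mem (nth 0%N js a) (w (k i)))%:R.
have : kermx M != 0.
  rewrite -mxrank_eq0 mxrank_ker subn_eq0 -ltnNge ltnS; exact: rank_leq_col.
move=> /rowV0Pn[v /sub_kermxP vM v0].
exists (size js).+1, k, (fun i => v 0 i); split => //.
  apply: contrapT => n; move: v0; apply/negP; rewrite negbK; apply/eqP/rowP => i.
  by rewrite mxE; apply: contrapT => /eqP vi; apply: n; exists i.
under eq_bigr do rewrite (sum_count ujs (fun j _ => @xjs j)) -sumrMnl.
rewrite exchange_big /= (big_nth 0%N) big_mkord big1 // => a _.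
under eq_bigr do rewrite -mulrnA; rewrite sumrMnr; apply: mulrn_Fp_eq0.
have := congr1 (fun z : 'rV_(size js) => z 0 a) vM; rewrite !mxE => <-.
rewrite natr_sum; apply: eq_bigr => i _.
by rewrite natrM natr_Zp mxE mulrC.
Qed.

(** Linear independence over the field with [P] elements. Repetitions in [w] serve as coefficients,
    and testing against every [xi] says that all multiplicities vanish modulo [P]. *)
Definition linearly_free (I : Type) (h : I -> V) : Prop :=
  forall w : seq I, \sum_(i <- w) h i = 0 ->
  forall xi : I -> 'F_P, \sum_(i <- w) xi i = 0.

Lemma Fp_order : of_order P 'F_P.
Proof. by move=> a; rewrite -mulr_natr (pcharf0 (pchar_Fp prP)) mulr0. Qed.

End Relation.

(** Finitely many vectors span a finite subgroup, so an infinite [V] always has a next vector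
    outside the span. *)
Lemma exists_linearly_free_nat (P : nat) (V : zmodType) : prime P -> of_order P V ->
  infinite_set [set: V] -> exists h : nat -> V, linearly_free P h.
Proof.
move=> prP VP Vinf.
have [|n x x' y xx' h c|n x _|h hP] := @wf_choice nat V (fun m n => (m < n)%N) 0
  (fun n x y => forall c : nat -> nat, y <> \sum_(j < n) x j *+ c j).
- by move=> n; elim: n {-2}n (leqnn n) => [|N IH] n nN; constructor=> m mn;
    [move: (leq_trans mn nN)|apply: IH; rewrite -ltnS; exact: leq_trans nN].
- by have := h c; under eq_bigr do rewrite xx' //.
- apply: contrapT => ny; apply: Vinf.
  have finS := @finite_image _ _ [set: {ffun 'I_n -> 'F_P}]
    (fun c => \sum_(j < n) x j *+ c j) finite_finset.
  apply: sub_finite_set finS => y _; apply: contrapT => nyS; apply: ny; exists y => c yc.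
  apply: nyS; exists [ffun j : 'I_n => (c j)%:R] => //.
  rewrite yc; apply: eq_bigr => j _; rewrite ffunE.
  by apply: (mulrn_Fp prP VP); rewrite natr_Zp.
have free N (c : nat -> nat) : \sum_(j < N) h j *+ c j = 0 ->
    forall j, (j < N)%N -> (c j)%:R = 0 :> 'F_P.
  elim: N => [//|N IH]; rewrite big_ord_recr /= => sum0.
  have [cN0|cN] := eqVneq ((c N)%:R : 'F_P) 0.
    move: sum0; rewrite (mulrn_Fp_eq0 prP VP _ cN0) addr0 => /IH cj j.
    by rewrite ltnS leq_eqVlt => /predU1P[->//|]; exact: cj.
  (* [k] represents the negative inverse of [c N]. Multiplying the relation by it expresses [h N]
     through its predecessors. *)
  pose inv : 'F_P := (c N)%:R^-1; pose k := (P.-1 * inv)%N.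
  have Pm1 : P.-1%:R = -1 :> 'F_P.
    apply/eqP; rewrite -addr_eq0 natr1 prednK ?prime_gt0 //.
    by rewrite (pcharf0 (pchar_Fp prP)).
  case: (hP N (fun j => (c j * k)%N)).
  under eq_bigr do rewrite mulrnA; rewrite sumrMnl.
  apply: (addIr (h N *+ c N *+ k)); rewrite -mulrnDl sum0 mul0rn -mulrnA -mulrS.
  apply: (mulrn_Fp_eq0 prP VP); rewrite -natr1 natrM natrM Pm1 natr_Zp.
  by rewrite mulN1r mulrN divff // addNr.
exists h => w hw xi; pose N := (\max_(j <- w) j).+1.
have wN j : j \in w -> (j < N)%N by rewrite ltnS => /(@leq_bigmax_seq _ w xpredT id j)->.
have sumE (U : zmodType) (g : nat -> U) :
    \sum_(j <- w) g j = \sum_(j < N) g j *+ count_mem (nat_of_ord j) w.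
  rewrite (@sum_count U (index_iota 0 N) w g) ?iota_uniq ?big_mkord // => j jw _.
  by rewrite mem_index_iota /= wN.
rewrite sumE big1 // => j _; apply: (mulrn_Fp_eq0 prP (Fp_order prP)).
by apply: (free N (fun j => count_mem j w)) => //; rewrite -sumE.
Qed.

Lemma exists_linearly_free (I : countType) (P : nat) (V : zmodType) : prime P ->
  of_order P V -> infinite_set [set: V] -> exists h : I -> V, linearly_free P h.
Proof.
move=> prP VP Vinf; have [h hfree] := exists_linearly_free_nat prP VP Vinf.
exists (h \o pickle) => w hw xi.
have := hfree (map pickle w) ^~ (fun j => if unpickle j is Some i then xi i else 0).
rewrite !big_map => /(_ hw) xi0; rewrite -[RHS]xi0; apply: eq_bigr => i _.
by rewrite pickleK.
Qed.

(** * The transfinite construction *)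

Section Construction.
Variables (P : nat) (H : topologicalZmodType) (K T : Type) (lt : T -> T -> Prop).
Hypothesis prP : prime P.

Local Notation ambient := (H * ((seq bool -> 'F_P) -> 'F_P))%type.

Lemma fst_sum (I : Type) (w : seq I) (a : I -> ambient) :
  (\sum_(j <- w) a j).1 = \sum_(j <- w) (a j).1.
Proof. by elim: w => [|j w IH]; rewrite ?big_nil // !big_cons /= IH. Qed.

Lemma snd_sum (I : Type) (w : seq I) (a : I -> ambient) xi :
  (\sum_(j <- w) a j).2 xi = \sum_(j <- w) (a j).2 xi.
Proof. by elim: w => [|j w IH]; rewrite ?big_nil // !big_cons /= -IH. Qed.

Lemma snd_muln (a : ambient) n xi : (a *+ n).2 xi = a.2 xi *+ n.
Proof. by elim: n => [|n IH]; rewrite ?mulr0n // !mulrS /= -IH. Qed.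

Hypothesis HP : of_order P H.

Lemma ambient_order : of_order P ambient.
Proof.
move=> a; have fst_muln n : (a *+ n).1 = a.1 *+ n.
  by elim: n => [|n IH]; rewrite ?mulr0n // !mulrS /= -IH.
have : (a *+ P).1 = 0 by rewrite fst_muln HP.
have : (a *+ P).2 = 0.
  apply/funext => xi; rewrite snd_muln -mulr_natr.
  by rewrite (pcharf0 (pchar_Fp prP)) mulr0.
by case: (a *+ P) => ? ? /= -> ->.
Qed.

(** * Words and spans *)

Variable h : seq bool -> H.

Definition base (q : seq bool) : ambient := (h q, fun xi => xi q).

Definition gen (x : T -> nat -> ambient) (g : seq bool + T * nat) : ambient :=
  match g with inl q => base q | inr (t, j) => x t j end.

(** The type itself restricts the stages to [U], so a bound on the size of [U] bounds the number of
    words. *)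
Definition word_in (U : T -> Prop) : Type := seq (seq bool + {t | U t} * nat).

Definition eval_in (U : T -> Prop) (x : T -> nat -> ambient) (w : word_in U) : ambient :=
  \sum_(g <- w) match g with inl q => base q | inr (t, j) => x (sval t) j end.

(* Words need neither coefficients nor inverses, since P annihilates the
   ambient group. *)
Definition span (U : T -> Prop) (x : T -> nat -> ambient) : set ambient :=
  [set v | exists w : word_in U, v = eval_in x w].

Lemma span_ind (U : T -> Prop) x (Q : ambient -> Prop) :
  Q 0 -> (forall q v, Q v -> Q (base q + v)) ->
  (forall t j v, U t -> Q v -> Q (x t j + v)) -> forall v, span U x v -> Q v.
Proof.
move=> Q0 Qb Qx _ [w ->]; rewrite /eval_in.
elim: w => [|[q|[[t Ut] j]] w IH]; rewrite ?big_nil // big_cons; first exact: Qb.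
exact: Qx.
Qed.

Section Span.
Variables (U : T -> Prop) (x : T -> nat -> ambient).

Lemma span0 : span U x 0.
Proof. by exists [::]; rewrite /eval_in big_nil. Qed.

Lemma spanD u v : span U x u -> span U x v -> span U x (u + v).
Proof. by move=> [w ->] [w' ->]; exists (w ++ w'); rewrite /eval_in big_cat. Qed.

Lemma span_muln u n : span U x u -> span U x (u *+ n).
Proof.
move=> xu; elim: n => [|n IH]; first exact: span0.
by rewrite mulrS; exact: spanD.
Qed.

Lemma spanN u : span U x u -> span U x (- u).
Proof.
move=> xu; suff -> : - u = u *+ P.-1 by exact: span_muln.
apply/eqP; rewrite eq_sym -addr_eq0 -mulrSr prednK ?prime_gt0 //.
exact/eqP/ambient_order.
Qed.

Lemma spanB u v : span U x u -> span U x v -> span U x (u - v).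
Proof. by move=> xu xv; apply: spanD => //; exact: spanN. Qed.

Lemma span_sum (I : Type) (w : seq I) (a : I -> ambient) :
  (forall i, span U x (a i)) -> span U x (\sum_(i <- w) a i).
Proof.
move=> xa; elim: w => [|i w IH]; first by rewrite big_nil; exact: span0.
by rewrite big_cons; exact: spanD.
Qed.

Lemma span_base q : span U x (base q).
Proof. by exists [:: inl q]; rewrite /eval_in big_seq1. Qed.

Lemma span_gen t j : U t -> span U x (x t j).
Proof. by move=> Ut; exists [:: inr (exist _ t Ut, j)]; rewrite /eval_in big_seq1. Qed.

End Span.

Lemma sub_span (U U' : T -> Prop) x x' : (forall t, U t -> U' t) ->
  (forall t, U t -> x t = x' t) -> span U x `<=` span U' x'.
Proof.
move=> UU' xx' v; elim/span_ind => [|q u|t j u Ut]; first exact: span0.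
- by apply: spanD; exact: span_base.
- by apply: spanD; rewrite xx' //; exact/span_gen/UU'.
Qed.

Lemma eq_span (U : T -> Prop) x x' : (forall t, U t -> x t = x' t) ->
  span U x = span U x'.
Proof.
by move=> xx'; apply/seteqP; split; apply: sub_span => // t /xx'.
Qed.

(** * Limits of branches *)

(** Convergence in the product of [H] with a power of the discrete field. *)
Definition limit (p : set_system nat) (u : nat -> ambient) (y : ambient) : Prop :=
  (fun n => (u n).1) @ p --> y.1 /\ forall xi, p [set n | (u n).2 xi = y.2 xi].

Hypothesis Hhaus : hausdorff_space H.

Lemma limit_unique p u y y' : UltraFilter p -> limit p u y -> limit p u y' -> y = y'.
Proof.
move=> pU [y1 y2] [y1' y2']; rewrite (surjective_pairing y) (surjective_pairing y').
congr pair; first exact: (cvg_unique Hhaus) y1 y1'.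
apply/funext => xi; have [n [/= <- <-]] := filter_ex (filterI (y2 xi) (y2' xi)).
by [].
Qed.

Lemma limit_cst p (u : nat -> ambient) y : Filter p -> p [set n | u n = y] -> limit p u y.
Proof.
move=> pF uy; split; last by move=> xi; apply: filterS uy => n /= ->.
move=> O yO; have Oy := nbhs_singleton yO.
suff : p [set n | O (u n).1] by [].
by apply: filterS uy => n /= ->.
Qed.

Lemma limit_sum (I : Type) (p : set_system nat) (w : seq I) (s : nat -> I -> ambient)
    (y : I -> ambient) : Filter p -> (forall j, limit p (s ^~ j) (y j)) ->
  limit p (fun n => \sum_(j <- w) s n j) (\sum_(j <- w) y j).
Proof.
move=> pF sy; split.
  rewrite fst_sum; under eq_fun do rewrite fst_sum.
  by apply: cvg_sum => j; case: (sy j).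
move=> xi; rewrite snd_sum; elim: w => [|j w IH].
  by apply: filterS filterT => n _ /=; rewrite big_nil !big_nil.
have [_ /(_ xi) syj] := sy j; apply: filterS (filterI syj IH) => n /= [sj sw].
by rewrite snd_sum in sw; rewrite snd_sum !big_cons sj sw.
Qed.

Variable rho : K -> cantor.
Hypothesis rho_inj : injective rho.
Variable k0 : K.

Definition branch (i : K) (n : nat) : ambient := base (mkseq (rho i) n).

(* v has the second coordinate of a p-limit of a nontrivial combination of
   branches of the binary tree; its first coordinate is unconstrained. *)
Definition related (v : ambient) (p : set_system nat) : Prop :=
  exists m (r : 'I_m -> cantor) (c : 'I_m -> 'F_P),
    [/\ injective r, exists k, c k != 0 &
     forall xi, p [set n | v.2 xi = \sum_k c k * xi (mkseq (r k) n)]].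

(** Let [xi] be the indicator of the long prefixes of a branch [r k] with nonzero coefficient, at
    lengths in [A]. Beyond [N] the other branches have left [r k], so the value is [c k]. *)
Lemma related_support v p (A : set nat) : free_ultra p -> related v p -> p A ->
  exists xi, (forall q, ~ A (size q) -> xi q = 0) /\ v.2 xi != 0.
Proof.
move=> [pU pN] [m [r [c [rinj [k ck] vc]]]] pA.
have /choice[d dP] i : exists j, i <> k -> r i j <> r k j.
  have [->|ik] := pselect (i = k); first by exists 0%N.
  apply: contrapT => n; apply: ik; apply: rinj; apply/funext => j.
  by apply: contrapT => rij; apply: n; exists j.
pose N := (\max_i d i).+1.
pose xi q : 'F_P := if (N <= size q)%N && `[< A (size q) >] &&
  (q == mkseq (r k) (size q)) then 1 else 0.
exists xi; split=> [q nA|]; first by rewrite /xi asboolF // andbF.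
have [n [[/= Nn An] ->]] := filter_ex (filterI (filterI (pN N) pA) (vc xi)).
rewrite (bigD1 k) //= big1 ?addr0 => [|i /eqP ik].
  by rewrite /xi size_mkseq Nn asboolT //= eqxx mulr1.
rewrite /xi size_mkseq [X in _ && X]negbTE ?andbF ?mulr0 //.
apply/eqP => /(congr1 (nth false ^~ (d i))).
have dn : (d i < n)%N by apply: leq_trans Nn; rewrite ltnS; exact: leq_bigmax.
by rewrite !nth_mkseq //; exact: dP.
Qed.

(** If [A] is in [p] but not in [q], a function supported on levels in [A] takes a nonzero value by
    [p] and the value zero by [q]. *)
Lemma related_inj v p q : free_ultra p -> free_ultra q ->
  related v p -> related v q -> p = q.
Proof.
move=> pf qf vp vq; have [pU _] := pf; have [qU _] := qf.
suff pq : p `<=` q by apply/esym/max_filter.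
move=> A pA; apply: contrapT => nqA.
have [xi [xiA /eqP vxi]] := related_support pf vp pA; apply: vxi.
have [m [r [c [_ _ vc]]]] := vq.
have [n [/= nA ->]] := filter_ex (filterI (ultra_not qU nqA) (vc xi)).
by rewrite big1 // => k _; rewrite xiA ?size_mkseq ?mulr0.
Qed.

(** A combination of base vectors sees only finitely many nodes, whereas a related vector is nonzero
    on some function living on arbitrarily deep levels. *)
Lemma related_not_base v p x : free_ultra p -> related v p ->
  ~ span (fun=> False) x v.
Proof.
move=> pf vp vE; have [N NP] : exists N, forall xi : seq bool -> 'F_P,
    (forall q, (size q < N)%N -> xi q = 0) -> v.2 xi = 0.
  move: v vE {vp}; apply: span_ind => [|q v [N NP]|//]; first by exists 0%N.
  exists (maxn N (size q).+1) => xi xi0 /=; rewrite /GRing.add /= NP ?xi0 ?addr0 //.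
    by rewrite leq_max ltnSn orbT.
  by move=> q' q'N; rewrite xi0 // leq_max q'N.
have [_ pN] := pf; have [xi [xi0 /eqP]] := related_support pf vp (pN N); apply.
by apply: NP => q qN; apply: xi0; apply/negP; rewrite -ltnNge.
Qed.

Lemma limit_related i p y : limit p (branch i) y -> related y p.
Proof.
move=> [_ y2]; exists 1%N, (fun=> rho i), (fun=> 1); split.
- by move=> a b _; rewrite !ord1.
- by exists ord0; rewrite oner_eq0.
- move=> xi; have := y2 xi; congr p; apply/seteqP; split=> n /=;
  by rewrite big_ord1 mul1r.
Qed.

(* The junk value [k0] is taken when every branch has a p-limit in S. *)
Definition escape (S : set ambient) (p : set_system nat) : K :=
  if pselect (exists i, forall y, S y -> ~ limit p (branch i) y) is left e
  then projT1 (cid e) else k0.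

Lemma escapeP (S : set ambient) p :
  (exists i, forall y, S y -> ~ limit p (branch i) y) ->
  forall y, S y -> ~ limit p (branch (escape S p)) y.
Proof. by move=> e; rewrite /escape; case: pselect => // e'; case: cid. Qed.

(** * Forbidden first coordinates *)

Definition below (t : T) : T -> Prop := fun t' => lt t' t.
Definition upto (t : T) : T -> Prop := fun t' => lt t' t \/ t' = t.

Definition target (S : set ambient) (p : set_system nat) (y : H) : Prop :=
  (fun n => (branch (escape S p) n).1) @ p --> y.

(* First coordinates that a new combination x at stage t must avoid: [- u.1]
   would make the projection of u + x to H vanish, and [y - u.1] would make
   u + x a p-limit of an escaping branch. *)
Definition forbidden (t : T) (x : T -> nat -> ambient) : set H :=
  [set z | exists u, span (below t) x u /\ (z = - u.1 \/
    exists t' v p y, [/\ lt t' t, span (upto t') x v, free_ultra p /\ related v p,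
      target (span (upto t') x) p y & z = y - u.1])].

Hypothesis trans : forall t1 t2 t3, lt t1 t2 -> lt t2 t3 -> lt t1 t3.
Hypothesis smallT : forall t, small {t' | lt t' t}.

Lemma upto_below t t' t'' : lt t' t -> upto t' t'' -> below t t''.
Proof. by move=> t't [t''t'|->] //; exact: trans t't. Qed.

Lemma forbidden_local t x x' : (forall t', lt t' t -> x t' = x' t') ->
  forbidden t x = forbidden t x'.
Proof.
move=> xx'; have sp t' : lt t' t -> span (upto t') x = span (upto t') x'.
  by move=> t't; apply: eq_span => t'' /(upto_below t't) /xx'.
have sp' : span (below t) x = span (below t) x' by apply: eq_span => t' /xx'.
apply/seteqP; split=> z [u [xu zu]]; exists u.
  rewrite -sp'; split=> //; case: zu => [->|]; first by left.
  move=> [t' [v [p [y [t't]]]]]; rewrite sp // => vt' vp yt' zu.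
  by right; exists t', v, p, y.
rewrite sp'; split=> //; case: zu => [->|]; first by left.
move=> [t' [v [p [y [t't]]]]]; rewrite -sp // => vt' vp yt' zu.
by right; exists t', v, p, y.
Qed.

(** A forbidden value is determined by a word for [u] and possibly a stage [t'] with a word for [v]:
    the vector [v] determines [p], and [p] with [t'] determines [y]. *)
Lemma small_forbidden t x : small {z | forbidden t x z}.
Proof.
(* The summand [nat] makes [Y] infinite even when [t] has few predecessors. *)
pose Y := ({t' | lt t' t} + nat)%type.
have Yabs : absorbing Y.
  by apply: absorbing_infinite; exists inr => ? ? [].
have tY : embeds {t' | lt t' t} Y by exists inl => ? ? [].
have wY : embeds (word_in (below t)) Y.
  apply: absorbing_seq => //; apply: absorbing_sum => //.
    exact: absorbing_count.
  by apply: absorbing_prod => //; exact: absorbing_count.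
pose J := (word_in (below t) * option ({t' | lt t' t} * word_in (below t)))%type.
have JY : embeds J Y.
  apply: absorbing_prod => //; apply: absorbing_option => //.
  exact: absorbing_prod.
apply: (@small_embeds _ Y); last first.
  by apply: small_sum; [exact: smallT|exact: (@small_count nat)].
apply: embeds_trans JY.
pose code (j : J) (z : H) := match j.2 with
  | None => z = - (eval_in x j.1).1
  | Some (t', w) => exists p y, [/\ free_ultra p, related (eval_in x w) p,
      target (span (upto (sval t')) x) p y & z = y - (eval_in x j.1).1] end.
have codeF j z z' : code j z -> code j z' -> z = z'.
  case: j => w [[t' w']|]; rewrite /code /=; last by move=> -> ->.
  move=> [p [y [pf wp ty ->]]] [p' [y' [pf' wp' ty' ->]]].
  have pp' := related_inj pf pf' wp wp'; rewrite -{}pp' in ty'.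
  have [pU _] := pf; congr (_ - _); exact: (cvg_unique Hhaus) ty ty'.
have /choice[f fP] (z : {z | forbidden t x z}) : exists j, code j (sval z).
  case: z => z [u [[w uw] zu]] /=; case: zu => [zE|].
    by exists (w, None); rewrite /code /= zE uw.
  move=> [t' [v [p [y [t't vt' [pf vp] ty zE]]]]].
  have [w' vw'] : span (below t) x v.
    by apply: sub_span vt' => // t'' /(upto_below t't).
  exists (w, Some (exist _ t' t't, w')); rewrite /code /=.
  by exists p, y; rewrite -vw' -uw.
exists f => z z' e; apply: sval_inj; apply: codeF (fP z) _.
by rewrite e; exact: fP.
Qed.

(** * Tasks and stages *)

Definition eval (x : T -> nat -> ambient) (w : seq (seq bool + T * nat)) : ambient :=
  \sum_(g <- w) gen x g.

Fixpoint refers_to (U : T -> Prop) (w : seq (seq bool + T * nat)) : Prop :=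
  match w with
  | [::] => True
  | inl _ :: w' => refers_to U w'
  | inr (t, _) :: w' => U t /\ refers_to U w'
  end.

Lemma eval_span U x w : refers_to U w -> span U x (eval x w).
Proof.
rewrite /eval; elim: w => [_|[q|[t j]] w IH /=]; first by rewrite big_nil; exact: span0.
  by move=> /IH; rewrite big_cons; apply: spanD; exact: span_base.
by move=> [Ut /IH]; rewrite big_cons; apply: spanD; exact: span_gen.
Qed.

Lemma eval_local U x x' w : (forall t, U t -> x t = x' t) -> refers_to U w ->
  eval x w = eval x' w.
Proof.
move=> xx'; rewrite /eval; elim: w => [_|[q|[t j]] w IH /=]; first by rewrite !big_nil.
  by move=> /IH e; rewrite !big_cons e.
by move=> [Ut /IH e]; rewrite !big_cons e /= xx'.
Qed.

(** A code for countably many sequences, with time as first argument. Words are used because tasks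
    are enumerated before the generators exist. *)
Definition task : Type := nat -> nat -> seq (seq bool + T * nat).

Variable e : T -> task.

Definition valid (t : T) (x : T -> nat -> ambient) : Prop :=
  [/\ forall n j, refers_to (below t) (e t n j),
      ~ embeds K {j | exists n, eval x (e t n j) <> 0} &
      always_clusters (fun n j => (eval x (e t n j)).1)].

(** [good_support] keeps the number of new generators below [K], for the dimension count.
    [good_avoid] preserves injectivity of the projection and the absence of limits of escaping
    branches. [good_limit] fulfils the task. *)
Record good (t : T) (x : T -> nat -> ambient) (y : nat -> ambient) : Prop := Good {
  good_support : ~ embeds K {j | y j <> 0};
  good_avoid : forall w : seq nat, span (below t) x (\sum_(j <- w) y j) \/
    ~ forbidden t x (\sum_(j <- w) y j).1;
  good_limit : valid t x -> exists2 p, free_ultra p &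
    forall j, limit p (fun n => eval x (e t n j)) (y j) }.

Lemma good_local t x x' y : (forall t', lt t' t -> x t' = x' t') ->
  good t x y -> good t x' y.
Proof.
move=> xx' [supp avoid lim]; split=> //.
  move=> w; rewrite -(forbidden_local xx').
  by rewrite -(@eq_span (below t) x x').
move=> [ref' supp' acc'].
have evE n j : eval x (e t n j) = eval x' (e t n j) by exact: eval_local (ref' n j).
have [|p pf pl] := lim.
  split=> //.
    have -> // : {j | exists n, eval x (e t n j) <> 0} =
                 {j | exists n, eval x' (e t n j) <> 0}.
    congr sig; apply/funext => j; apply/propext.
    by split=> -[n ?]; exists n; rewrite ?evE // -evE.
  move=> B /acc'[p [y' [pf pB py]]]; exists p, y'; split=> // j.
  by under eq_fun do rewrite evE; exact: py.
exists p => // j; have [l1 l2] := pl j; split.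
  by under eq_fun do rewrite -evE.
by move=> xi; have := l2 xi; under eq_set do rewrite evE.
Qed.

Hypothesis wf : well_founded lt.
Hypothesis tri : forall t t', [\/ lt t t', t = t' | lt t' t].

(** * The stage at which an element appears *)

Lemma span_enter (U : T -> Prop) x v : span U x v ->
  span (fun=> False) x v \/ exists2 t, U t & span (upto t) x v.
Proof.
elim/span_ind => [|q u [uE|[t Ut ut]]|t j u Ut [uE|[t' Ut' ut']]].
- by left; exact: span0.
- by left; apply: spanD => //; exact: span_base.
- by right; exists t => //; apply: spanD => //; exact: span_base.
- right; exists t => //; apply: spanD; first by apply: span_gen; right.
  exact: sub_span uE.
- right; have [tt'|tt'|t't] := tri t t'.
  + by exists t' => //; apply: spanD => //; apply: span_gen; left.
  + by exists t' => //; apply: spanD => //; apply: span_gen; right.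
  + exists t => //; apply: spanD; first by apply: span_gen; right.
    by apply: sub_span ut' => // t'' /(upto_below t't); left.
Qed.

Lemma span_first (U : T -> Prop) x v : (forall t t', U t -> lt t' t -> U t') ->
  span U x v -> span (fun=> False) x v \/
    exists t, [/\ U t, span (upto t) x v & ~ span (below t) x v].
Proof.
move=> Udown /span_enter[|[t]]; first by left.
elim/(well_founded_ind wf): t => t IH Ut vt.
have [vt'|] := pselect (span (below t) x v); last by right; exists t.
have [|[t' t't v't]] := span_enter vt'; first by left.
exact: IH t't (Udown _ _ Ut t't) v't.
Qed.

Lemma span_upto t x v : span (upto t) x v ->
  exists u w, span (below t) x u /\ v = u + \sum_(j <- w) x t j.
Proof.
elim/span_ind => [|q v' [u [w [ub ->]]]|t' j v' tt' [u [w [ub ->]]]].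
- by exists 0, [::]; rewrite big_nil addr0; split=> //; exact: span0.
- exists (base q + u), w; rewrite addrA; split=> //; apply: spanD => //.
  exact: span_base.
case: tt' => [t't|->].
  exists (x t' j + u), w; rewrite addrA; split=> //; apply: spanD => //.
  exact: span_gen.
by exists u, (j :: w); rewrite big_cons addrCA.
Qed.

Hypothesis h_free : linearly_free P h.

(** At its first stage, [v] is an old [u] plus a combination that is not old. The first coordinate
    of the latter must avoid [- u.1]. On base vectors the claim is the independence of [h]. *)
Lemma fst_injective (U : T -> Prop) x : (forall t t', U t -> lt t' t -> U t') ->
  (forall t, U t -> good t x (x t)) -> forall v, span U x v -> v.1 = 0 -> v = 0.
Proof.
move=> Udown xgood v /(span_first Udown)[vE|[t [Ut vt nvt]]] v0.
  have [w vw] : exists w, v = \sum_(q <- w) base q.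
    move: v vE {v0}; apply: span_ind => [|q v [w ->]|//].
      by exists [::]; rewrite big_nil.
    by exists (q :: w); rewrite big_cons.
  have w0 : \sum_(q <- w) h q = 0 by have := v0; rewrite vw fst_sum.
  rewrite (surjective_pairing v) v0; congr pair; apply/funext => xi.
  by rewrite vw snd_sum; exact: h_free.
have [u [w [ub vE]]] := span_upto vt; case: nvt; rewrite vE; apply: spanD => //.
have [//|] := good_avoid (xgood t Ut) w; case; exists u; split=> //; left.
by apply/eqP; rewrite -addr_eq0 addrC; move: v0; rewrite vE => /= ->.
Qed.

Hypothesis nconv : no_nontrivial_convergent_sequences H.

(** The first coordinates come from [avoiding_limit] applied with the forbidden set. The second ones
    converge along any ultrafilter because the field is finite. *)
Lemma exists_stage t x : (forall t', lt t' t -> good t' x (x t')) ->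
  exists y, good t x y.
Proof.
move=> xgood.
have [[ref supp acc]|nv] := pselect (valid t x); last first.
  (* An invalid task is answered by zeros; [k0] shows that [K] does not embed in the empty
     support. *)
  exists (fun=> 0); split=> //.
  - by case=> f _; case: (f k0).
  - by move=> w; left; rewrite big1 //; exact: span0.
set s := fun n j => eval x (e t n j).
have sb n j : span (below t) x (s n j) by exact: eval_span.
have [p [xH [pf sx avoid]]] := avoiding_limit nconv acc (@small_forbidden t x).
have [pU pN] := pf.
have /choice[g gP] (z : nat * (seq bool -> 'F_P)) :
    exists a, p [set n | (s n z.1).2 z.2 = a] by exact: ultra_fin.
pose y j : ambient := (xH j, fun xi => g (j, xi)).
have sy j : limit p (s ^~ j) (y j) by split=> [|xi]; [exact: sx|exact: (gP (j, xi))].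
exists y; split.
- move=> Ky; apply: supp; apply: embeds_trans Ky _.
  have yP j : y j <> 0 -> exists n, eval x (e t n j) <> 0.
    move=> yj; apply: contrapT => n; apply: yj; apply: (limit_unique pU (sy j)).
    apply: limit_cst; apply: filterS filterT => m _ /=.
    by apply: contrapT => sm; apply: n; exists m.
  exists (fun j : {j | y j <> 0} => exist _ (sval j) (yP _ (svalP j))) => i j [].
  exact: sval_inj.
(* If the first coordinates of the combination are constant on a set of [p], injectivity of the
   projection below [t] makes the combination itself constant there, so its limit is old. *)
- move=> w; have [[v pv]|] := avoid w; last by right; rewrite fst_sum.
  left; have [n0 /= n0v] := filter_ex pv.
  have swb n : span (below t) x (\sum_(j <- w) s n j) by exact: span_sum.
  suff -> : \sum_(j <- w) y j = \sum_(j <- w) s n0 j by [].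
  have pF : Filter p by exact: ultra_proper.
  apply: (@limit_unique p _ _ _ pU (limit_sum w pF sy)); apply: limit_cst.
  apply: filterS pv => n /= nv; apply/eqP; rewrite -subr_eq0; apply/eqP.
  apply: (@fst_injective (below t) x) => //.
  + by move=> t1 t2 h1 h2; exact: trans h1.
  + exact: spanB.
  + by rewrite /= !fst_sum nv n0v subrr.
- by move=> _; exists p.
Qed.

Lemma exists_good : exists x, forall t, good t x (x t).
Proof.
apply: (wf_choice (fun=> 0) wf); first exact: good_local.
exact: exists_stage.
Qed.

(** * The limits present and absent in the constructed group *)

Section Subgroup.
Variable x : T -> nat -> ambient.
Hypothesis xgood : forall t, good t x (x t).

Definition full : set ambient := span (fun=> True) x.

Lemma full_fst_injective v : full v -> v.1 = 0 -> v = 0.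
Proof. exact: fst_injective. Qed.

Lemma branches_have_no_limit (y : K -> ambient) p : free_ultra p ->
  (forall i, full (y i)) -> ~ (forall i, limit p (branch i) (y i)).
Proof.
move=> pf yfull ylim; have [pU pN] := pf.
(* Descend to the first stage whose span contains a vector related to [p]. *)
have first_entry v t : related v p -> span (upto t) x v ->
    exists t v, [/\ related v p, span (upto t) x v &
      forall t' v', lt t' t -> related v' p -> ~ span (upto t') x v'].
  elim/(well_founded_ind wf): t v => t IH v vp vt.
  have [[t' [v' [t't vp' vt']]]|n] := pselect (exists t' v',
      [/\ lt t' t, related v' p & span (upto t') x v']).
    exact: IH vp' vt'.
  exists t, v; split=> // t' v' t't vp' vt'; apply: n.
  by exists t', v'.
have [t [v [vp vt tmin]]] : exists t v, [/\ related v p, span (upto t) x v &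
    forall t' v', lt t' t -> related v' p -> ~ span (upto t') x v'].
  have yp := limit_related (ylim k0).
  have [/(related_not_base pf yp)//|[t _ yt]] := span_enter (yfull k0).
  exact: first_entry yp yt.
have [i iP] : exists i, forall z, span (upto t) x z -> ~ limit p (branch i) z.
  suff [i yi] : exists i, ~ span (upto t) x (y i).
    exists i => z zt zi; apply: yi.
    by rewrite -(limit_unique pU zi (ylim i)).
  (* Otherwise every [y i] is an old part plus a combination of fewer than [K] new generators. A
     relation among these combinations cancels them, and the same relation among the [y i] gives a
     vector related to [p] at an earlier stage. *)
  apply: contrapT => nall.
  have /choice[u uP] i : exists u, exists w, span (below t) x u /\ y i = u + \sum_(j <- w) x t j.
    by apply: span_upto; apply: contrapT => yi; apply: nall; exists i.
  have [w wP] := choice uP.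
  have [m [k [c [kinj cn0 ckw]]]] :=
    linear_relation prP ambient_order w (good_support (xgood t)).
  pose z := \sum_i y (k i) *+ c i.
  have zb : span (below t) x z.
    have -> : z = \sum_i u (k i) *+ c i.
      rewrite /z; under eq_bigr do rewrite (wP _).2 mulrnDl.
      by rewrite big_split /= ckw addr0.
    by apply: span_sum => a; apply: span_muln; case: (wP (k a)).
  have zp : related z p.
    exists m, (rho \o k), c; split=> //; first exact: inj_comp.
    move=> xi; rewrite /z snd_sum.
    have : p [set n | forall a : 'I_m, xi (mkseq (rho (k a)) n) = (y (k a)).2 xi].
      apply: (@filter_forall _ _ _ p _) => a.
      by case: (ylim (k a)) => _; apply.
    apply: filterS => n /= yn; apply: eq_bigr => a _.
    by rewrite yn snd_muln -mulr_natl natr_Zp.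
  have [/(related_not_base pf zp)//|[t' t't zt']] := span_enter zb.
  exact: tmin t't zp zt'.
(* The branch must be the one named by [escape], since later stages avoid only its limit. As [y k]
   enters at some [t'] after [t], its new part has the forbidden first coordinate
   [(y k).1 - u.1]. *)
pose S := span (upto t) x; pose k := escape S p.
have kP : forall z, S z -> ~ limit p (branch k) z by apply: escapeP; exists i.
have [/(related_not_base pf (limit_related (ylim k)))//|[t' [_ yt' nyt']]] :=
  span_first (fun _ _ _ _ => I) (yfull k).
have tt' : lt t t'.
  have nk := kP (y k); have [//|tt'|t't] := tri t t'; case: nk => //.
    by rewrite /S tt'.
  by apply: sub_span yt' => // t'' /(upto_below t't); left.
have [u [w [ub yE]]] := span_upto yt'.
have [wb|] := good_avoid (xgood t') w.
  by apply: nyt'; rewrite yE; exact: spanD.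
case; exists u; split=> //; right; exists t, v, p, (y k).1; split=> //.
  by case: (ylim k).
have -> : (y k).1 = u.1 + (\sum_(j <- w) x t' j).1 by rewrite yE.
by rewrite addrAC subrr add0r.
Qed.

Variable t0 : T.
Hypothesis e_cofinal : forall (s : task) (c : nat -> T), exists t,
  e t = s /\ forall n, lt (c n) t.

Lemma full_eval v : full v -> exists w, v = eval x w.
Proof.
elim/span_ind => [|q u [w ->]|t j u _ [w ->]].
- by exists [::]; rewrite /eval big_nil.
- by exists (inl q :: w); rewrite /eval big_cons.
- by exists (inr (t, j) :: w); rewrite /eval big_cons.
Qed.

Lemma refers_to_nth (U : T -> Prop) (w : seq (seq bool + T * nat)) :
  (forall a, if nth (inl [::]) w a is inr (t, _) then U t else True) -> refers_to U w.
Proof.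
elim: w => //= -[q|[t j]] w IH wU; first by apply: IH => a; exact: (wU a.+1).
by split; [exact: (wU 0%N)|apply: IH => a; exact: (wU a.+1)].
Qed.

(** Words for all the terms mention only countably many stages, so some later stage is assigned
    exactly this task and adds its limits. *)
Lemma full_clusters (u : nat -> nat -> ambient) : (forall n j, full (u n j)) ->
  ~ embeds K {j | exists n, u n j <> 0} ->
  always_clusters (fun n j => (u n j).1) ->
  exists p y, [/\ free_ultra p, forall j, full (y j) &
    forall j, limit p (u ^~ j) (y j)].
Proof.
move=> ufull usupp uacc.
have /choice[s sP] (z : nat * nat) : exists w, u z.1 z.2 = eval x w.
  exact: full_eval.
have [t [et ct]] := e_cofinal (fun n j => s (n, j))
  (* This lists every stage that occurs in the words, with [t0] as padding. *)
  (fun k => if unpickle k is Some (n, j, a) then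
     (if nth (inl [::]) (s (n, j)) a is inr (t, _) then t else t0) else t0).
have evE n j : eval x (e t n j) = u n j by rewrite et -(sP (n, j)).
have [|p pf pl] := good_limit (xgood t).
  split.
  - move=> n j; apply: refers_to_nth => a; rewrite et.
    have := ct (pickle (n, j, a)); rewrite pickleK.
    by case: (nth _ _ _) => // -[].
  - have -> // : {j | exists n, eval x (e t n j) <> 0} = {j | exists n, u n j <> 0}.
    congr sig; apply/funext => j; apply/propext.
    by split=> -[n ?]; exists n; rewrite ?evE // -evE.
  - move=> B /uacc[p [y [pf pB py]]]; exists p, y; split=> // j.
    by under eq_fun do rewrite evE; exact: py.
exists p, (x t); split=> //.
- by move=> j; exact: span_gen.
- by move=> j; have := pl j; under eq_fun do rewrite evE.
Qed.

End Subgroup.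

End Construction.

(** * The topology of the constructed group *)

Record subgroup (H : topologicalZmodType) (X : Type) (F : zmodType) := Subgroup {
  mem_of : set (H * (X -> F));
  mem_zero : mem_of 0;
  mem_sub : forall u v, mem_of u -> mem_of v -> mem_of (u - v)
}.

Section SubgroupTopology.
Variables (H : topologicalZmodType) (X : Type) (F : zmodType) (S : subgroup H X F).

Definition carrier : Type := {v | mem_of S v}.

HB.instance Definition _ := gen_eqMixin carrier.
HB.instance Definition _ := gen_choiceMixin carrier.

Let mem_opp v : mem_of S v -> mem_of S (- v).
Proof. by move=> Sv; rewrite -sub0r; apply: mem_sub => //; exact: mem_zero. Qed.

Let mem_add u v : mem_of S u -> mem_of S v -> mem_of S (u + v).
Proof. by move=> Su Sv; rewrite -[v]opprK; apply: mem_sub => //; exact: mem_opp. Qed.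

Let zero : carrier := exist _ 0 (mem_zero S).
Let opp (u : carrier) : carrier := exist _ (- sval u) (mem_opp (svalP u)).
Let add (u v : carrier) : carrier :=
  exist _ (sval u + sval v) (mem_add (svalP u) (svalP v)).

Let addA : associative add.
Proof. by move=> u v w; apply: sval_inj; rewrite /= addrA. Qed.

Let addC : commutative add.
Proof. by move=> u v; apply: sval_inj; rewrite /= addrC. Qed.

Let add0 : left_id zero add.
Proof. by move=> u; apply: sval_inj; rewrite /= add0r. Qed.

Let addN : left_inverse zero opp add.
Proof. by move=> u; apply: sval_inj; rewrite /= addNr. Qed.

HB.instance Definition _ := GRing.isZmodule.Build carrier addA addC add0 addN.

Lemma sval_sub (u v : carrier) : sval (u - v) = sval u - sval v.
Proof. by []. Qed.

Lemma sval_muln (u : carrier) n : sval (u *+ n) = sval u *+ n.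
Proof. by elim: n => [|n IH] //; rewrite !mulrS -IH. Qed.

(** The subspace topology of [H] times a power of the discrete [F]: basic neighbourhoods restrict
    the first coordinate and finitely many values of the second. *)
Definition carrier_nbhs (v : carrier) : set_system carrier :=
  [set W | exists O D, [/\ nbhs (sval v).1 O, finite_set D &
    forall w : carrier, O (sval w).1 ->
      (forall xi, D xi -> (sval w).2 xi = (sval v).2 xi) -> W w]].

HB.instance Definition _ := hasNbhs.Build carrier carrier_nbhs.

Let nbhs_proper (v : carrier) : ProperFilter (carrier_nbhs v).
Proof.
apply: Build_ProperFilter_ex.
  move=> W [O [D [vO _ OW]]]; exists v; apply: OW => //; exact: nbhs_singleton vO.
split.
- by exists setT, set0; split => //; exact: filterT.
- move=> W W' [O [D [vO Df OW]]] [O' [D' [vO' Df' OW']]].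
  exists (O `&` O'), (D `|` D'); split; first exact: filterI.
    by rewrite finite_setU.
  by move=> w [Ow O'w] wD; split; [apply: OW|apply: OW'] => // xi Dxi; apply: wD;
    [left|right].
- move=> W W' WW' [O [D [vO Df OW]]]; exists O, D; split => // w Ow wD.
  exact/WW'/OW.
Qed.

Let nbhs_center (v : carrier) W : carrier_nbhs v W -> W v.
Proof. by move=> [O [D [vO _]]]; apply => //; exact: nbhs_singleton vO. Qed.

Let nbhs_open (v : carrier) W : carrier_nbhs v W -> carrier_nbhs v (carrier_nbhs^~ W).
Proof.
move=> [O [D [vO Df OW]]]; exists O°, D; split => //; first exact: nbhs_interior.
move=> w Ow wD; exists O, D; split => // w' Ow' w'D; apply: OW => // xi Dxi.
by rewrite w'D // wD.
Qed.

HB.instance Definition _ := Nbhs_isNbhsTopological.Build carrier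
  nbhs_proper nbhs_center nbhs_open.

Lemma carrier_sub_continuous : continuous (fun z : carrier * carrier => z.1 - z.2).
Proof.
move=> [u v] /= W [O [D [uvO Df OW]]].
have : nbhs ((sval u).1, (sval v).1) [set z : H * H | O (z.1 - z.2)].
  exact: (@sub_continuous H ((sval u).1, (sval v).1)).
move=> [[O1 O2] /= [uO1 vO2] O12].
pose nb (O' : set H) (w : carrier) := [set w' : carrier | O' (sval w').1 /\
  forall xi, D xi -> (sval w').2 xi = (sval w).2 xi].
exists (nb O1 u, nb O2 v).
  by split; [exists O1, D|exists O2, D]; split.
move=> [w1 w2] [/= [Ow1 Dw1] [Ow2 Dw2]]; apply: OW => /=.
  exact: (O12 ((sval w1).1, (sval w2).1)).
by move=> xi Dxi; rewrite /GRing.add /GRing.opp /= Dw1 // Dw2.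
Qed.

HB.instance Definition _ :=
  PreTopologicalNmodule_isTopologicalZmodule.Build carrier carrier_sub_continuous.

Lemma carrier_cvg (I : Type) (p : set_system I) (u : I -> carrier) (y : carrier) :
  Filter p -> u @ p --> y <->
  (fun i => (sval (u i)).1) @ p --> (sval y).1 /\
    forall xi, p [set i | (sval (u i)).2 xi = (sval y).2 xi].
Proof.
move=> pF; split=> [uy|[uy1 uy2] W [O [D [yO Df OW]]]].
  split=> [O yO|xi].
    have /uy : nbhs y [set w : carrier | O (sval w).1].
      by exists O, set0; split.
    by [].
  have /uy : nbhs y [set w : carrier | (sval w).2 xi = (sval y).2 xi].
    exists setT, [set xi]; split => //; first exact: filterT.
    by move=> w _; apply.
  by [].
have [s Ds] := (@finite_seqP {classic X} D).1 Df.
have pD : p [set i | forall xi, D xi -> (sval (u i)).2 xi = (sval y).2 xi].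
  rewrite Ds; elim: s {Ds} => [|a s IH].
    by apply: filterS filterT => i _ xi.
  apply: filterS (filterI (uy2 a) IH) => i [/= ea es] xi /=.
  by rewrite inE => /predU1P[->//|]; exact: es.
have pO : p [set i | O (sval (u i)).1] := uy1 _ yO.
suff : p [set i | W (u i)] by [].
by apply: filterS (filterI pO pD) => i [/= Oi Di]; exact: OW.
Qed.

(** The projection to [H] is continuous and, by hypothesis, injective on the subgroup. *)
Lemma carrier_hausdorff : hausdorff_space H ->
  (forall v, mem_of S v -> v.1 = 0 -> v = 0) -> hausdorff_space carrier.
Proof.
move=> Hh inj u v uv; have e1 : (sval u).1 = (sval v).1.
  apply: Hh => O O' uO vO'.
  have [||w [Ow O'w]] := uv [set w : carrier | O (sval w).1] [set w : carrier | O' (sval w).1].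
  - by exists O, set0; split.
  - by exists O', set0; split.
  by exists (sval w).1.
apply/eqP; rewrite -subr_eq0; apply/eqP/sval_inj/inj; first exact: svalP.
by rewrite sval_sub /= e1 subrr.
Qed.

End SubgroupTopology.

(** * Accumulation points in powers, and the enumeration of tasks *)

Lemma ptws_cvg (I : Type) (X : topologicalType) (F : set_system (I -> X)) (f : I -> X) :
  Filter F -> (forall i, (fun g => g i) @ F --> f i) -> {ptws, F --> f}.
Proof.
move=> FF Ff; apply/cvg_sup => i; apply/cvg_image.
  by rewrite eqEsubset; split=> v // _; exists (cst v).
move=> W /= /Ff FW; exists ((fun g => g i) @^-1` W) => //.
by rewrite image_preimage // eqEsubset; split=> v // _; exists (cst v).
Qed.

Lemma ptws_proj (I J : Type) (X : topologicalType) (p : set_system J)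
    (u : J -> {ptws I -> X}) (x : {ptws I -> X}) (i : I) :
  u @ p --> x -> (fun j => u j i) @ p --> x i.
Proof.
move=> ux O xO.
by have /ux : nbhs x [set g : {ptws I -> X} | O (g i)] by
  exact: (@proj_continuous {classic I} (fun=> X) i x O xO).
Qed.

Lemma ultra_accumulation (X : topologicalType) (p : set_system nat) (u : nat -> X) (x : X) :
  free_ultra p -> u @ p --> x -> accumulation_point u x.
Proof.
move=> pf ux U xU; apply/infinite_unbounded/(free_unbounded pf); exact: ux.
Qed.

(** The traces on [B] of the preimages of neighbourhoods of [x] generate a filter of unbounded sets,
    which extends to a free ultrafilter. *)
Lemma accumulation_ultra (X : topologicalType) (v : nat -> X) (phi : nat -> nat)
    (B : set nat) (x : X) :
  (forall n, (n <= phi n)%N) -> (forall n, B (phi n)) ->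
  accumulation_point (v \o phi) x -> exists p, [/\ free_ultra p, p B & v @ p --> x].
Proof.
move=> nphi Bphi acc.
pose F := [set A | exists2 U, nbhs x U & B `&` v @^-1` U `<=` A].
have FF : Filter F.
  split.
  - by exists setT => //; exact: filterT.
  - move=> A A' [U xU UA] [U' xU' UA']; exists (U `&` U'); first exact: filterI.
    by move=> n [Bn [Un U'n]]; split; [apply: UA|apply: UA'].
  - by move=> A A' AA' [U xU UA]; exists U => //; exact: subset_trans AA'.
have [A [U xU UA]|p pf Fp] := exists_free_ultra FF.
  apply: unboundedS UA _ => N.
  have [n Nn Un] := (infinite_unbounded _).1 (acc U xU) N.
  by exists (phi n); [exact: leq_trans (nphi n)|split; [exact: Bphi|exact: Un]].
exists p; split=> //; first by apply: Fp; exists setT; [exact: filterT|move=> n []].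
by move=> U xU; apply: Fp; exists U => // n [].
Qed.

Lemma always_clusters_power (H : topologicalZmodType) (I : Type) (iota : I -> nat)
    (s : nat -> nat -> H) : injective iota -> countably_compact {ptws I -> H} ->
  (forall n j, (forall i, iota i <> j) -> s n j = 0) -> always_clusters s.
Proof.
move=> iotai cc s0 B Bub.
have /choice[phi phiP] n : exists m, (n <= m)%N /\ B m.
  by have [m nm Bm] := Bub n; exists m.
pose v n : {ptws I -> H} := fun i => s n (iota i).
have [x /accumulation_ultra] := cc (v \o phi).
move=> /(_ B (fun n => (phiP n).1) (fun n => (phiP n).2))[p [pf pB vx]].
have /choice[y yP] j : exists y : H, (fun n => s n j) @ p --> y.
  have [[i <-]|nj] := pselect (exists i, iota i = j).
    by exists (x i); exact: (ptws_proj (i := i) vx).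
  have [pU _] := pf; exists 0; have -> : (fun n => s n j) = fun=> 0.
    by apply/funext => n; apply: s0 => i ij; apply: nj; exists i.
  exact: cvg_cst.
by exists p, y.
Qed.

(** There are continuum many tasks, and each is listed with continuum many labels. The labels whose
    stage fails to exceed a given [c n] form a small set, so by [konig] one label works for all
    [n]. *)
Lemma exists_tasks (T : Type) (lt : T -> T -> Prop) :
  (forall t t', [\/ lt t t', t = t' | lt t' t]) ->
  (forall t, small {t' | lt t' t}) -> embeds cantor T -> embeds T cantor ->
  exists e : T -> task T, forall (s : task T) (c : nat -> T),
    exists t, e t = s /\ forall n, lt (c n) t.
Proof.
move=> tri smallT cT Tc.
have taskT : embeds (task T * cantor) T.
  apply: embeds_trans cT; have ac := absorbing_cantor.
  apply: (absorbing_prod ac); last by exists id.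
  apply: embeds_trans embeds_cantor_fun; apply: embeds_fun.
  apply: embeds_trans embeds_cantor_fun; apply: embeds_fun.
  apply: (absorbing_seq ac); apply: (absorbing_sum ac); first exact: (absorbing_count ac).
  by apply: (absorbing_prod ac) => //; exact: (absorbing_count ac).
have [E Esurj] := embeds_surj (fun _ _ => [::], xpred0) taskT.
exists (fun t => (E t).1) => s c.
have /choice[f fP] (r : cantor) : exists t, E t = (s, r) by exact: Esurj.
have fi : injective f by move=> r r' ff; have := fP r; rewrite ff fP => -[].
have [n|r rP] := @konig nat (fun n r => ~ lt (c n) (f r)).
  (* The point of [unit] stands for the single possible label with [f r = c n]. *)
  apply: (@small_embeds _ (unit + {t' | lt t' (c n)})); last first.
    by apply: small_sum (smallT _); exact: (@small_count unit).
  exists (fun r => match pselect (lt (f (sval r)) (c n)) with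
    | left h => inr (exist _ (f (sval r)) h) | right _ => inl tt end).
  move=> [r nr] [r' nr'] /=; case: pselect => h; case: pselect => h' //.
    by move=> [] /fi e; exact: sval_inj.
  move=> _; apply: sval_inj => /=; apply: fi.
  have eqc r1 : ~ lt (c n) (f r1) -> ~ lt (f r1) (c n) -> f r1 = c n.
    by move=> h1 h2; case: (tri (f r1) (c n)).
  exact: etrans (eqc r nr h) (esym (eqc r' nr' h')).
exists (f r); rewrite fP; split=> // n; apply: contrapT; exact: rP.
Qed.

(** * Powers of the constructed group *)

Theorem theorem20 (P : nat) (W K : Type) :
  prime P ->
  is_omega1 W ->
  [set: unit] #<= [set: K] ->
  [set: K] #<= [set: W] ->
  (exists H : topologicalZmodType,
    [/\ hausdorff_space H,
        of_order P H,
        infinite_set [set: H],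
        no_nontrivial_convergent_sequences H &
        forall I : Type, card_lt I K -> countably_compact {ptws I -> H}]) ->
  exists G : topologicalZmodType,
    [/\ hausdorff_space G,
        of_order P G,
        forall I : Type, card_lt I K -> countably_compact {ptws I -> G} &
        ~ countably_compact {ptws K -> G}].
Proof.
move=> prP W1 /embeds_cardE[unitK _] /embeds_cardE KW [H [Hh HP Hinf nconv Hcc]].
pose k0 := unitK tt.
have [rho rhoi] : embeds K cantor.
  by apply: embeds_trans KW _; apply: omega1_embeds => //; exact: small_count.
have [T [lt [wf trans tri smallT [cT Tc]]]] := exists_continuum_order.
have [e e_cofinal] := exists_tasks tri smallT cT Tc.
have [h hfree] := exists_linearly_free (seq bool) prP HP Hinf.
have [x xgood] := exists_good prP HP Hh rho k0 trans smallT e wf tri hfree nconv.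
pose t0 : T := projT1 (cid cT) xpred0.
have fullB u v : full h x u -> full h x v -> full h x (u - v).
  exact: (spanB prP HP).
pose S : subgroup H (seq bool -> 'F_P) 'F_P := Subgroup (span0 h _ x) fullB.
exists (carrier S); split.
- apply: carrier_hausdorff => // v; exact: (full_fst_injective trans wf tri hfree xgood).
- by move=> g; apply: sval_inj; rewrite sval_muln (ambient_order prP HP).
- move=> I IK u; have [/embeds_cardE[f _] nKI] := IK.
  (* An uncountable [I] would contain a copy of omega_1, hence of [K]. *)
  have [iota iotai] : embeds I nat.
    apply: contrapT => /(omega1_embeds W1) WI; apply: nKI; apply/embeds_cardE.
    exact: embeds_trans KW WI.
  (* The family is reindexed by natural numbers, with zero sequences at the indices outside the
     range of [iota]. *)
  pose U n j : H * ((seq bool -> 'F_P) -> 'F_P) :=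
    if pselect (exists i, iota i = j) is left e then sval (u n (projT1 (cid e))) else 0.
  have UE n i : U n (iota i) = sval (u n i).
    rewrite /U; case: pselect => [e'|[]]; last by exists i.
    by case: cid => i' /= /iotai ->.
  have U0 n j : (forall i, iota i <> j) -> U n j = 0.
    by move=> nj; rewrite /U; case: pselect => // -[i ij]; case: (nj i).
  have Ufull n j : full h x (U n j).
    by rewrite /U; case: pselect => [e'|_]; [exact: svalP|exact: span0].
  have [| |p [y [pf yfull Uy]]] := full_clusters xgood t0 e_cofinal Ufull.
  + move=> KJ; apply: nKI; apply/embeds_cardE; apply: embeds_trans KJ _.
    have /choice[g gP] (j : {j | exists n, U n j <> 0}) : exists i, iota i = sval j.
      case: j => j [n Unj] /=; apply: contrapT => nj; apply: Unj; apply: U0 => i ij.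
      by apply: nj; exists i.
    by exists g => j j' gg; apply: sval_inj; rewrite -!gP gg.
  + apply: always_clusters_power iotai (Hcc I IK) _ => n j nj.
    by rewrite U0.
  exists (fun i => exist _ (y (iota i)) (yfull (iota i))).
  apply: (ultra_accumulation pf); have [pU _] := pf.
  apply: ptws_cvg => i.
  suff : (fun n => u n i) @ p --> (exist _ _ (yfull (iota i)) : carrier S) by [].
  apply/carrier_cvg => /=; have [l1 l2] := Uy (iota i); split.
    by move: l1; under eq_fun do rewrite UE.
  by move=> xi; have := l2 xi; under eq_set do rewrite UE.
(* An accumulation point of the sequence formed by all [K] branches would give limits of all of them
   along one free ultrafilter. *)
- move=> cc; pose u n : {ptws K -> carrier S} :=
    fun i => exist _ (branch P h rho i n) (span_base h _ x _).
  have [y /(@accumulation_ultra _ u id setT)] := cc u.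
  move=> [//|//|p [pf _ uy]]; have [pU _] := pf.
  apply: (branches_have_no_limit prP HP Hh rhoi trans wf tri xgood pf
    (y := fun i => sval (y i))).
    by move=> i; exact: svalP.
  by move=> i; have /carrier_cvg := ptws_proj (i := i) uy.
Qed.
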